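(* Let $M,T,B>0$ and let $f\in\mathbb A^{(1)}_{M,T,B}$ with $f'(0)\neq0$. Let $$g_1=\frac12\,\frac{1-\phi_0^2-2\phi_1}{1-\phi_0^2},\qquad \phi_0=\frac{f(0)}{M},\quad \phi_1=\frac{T}{K}\,\frac{f'(0)}{M}.$$ Let $\tau\in(-T,T)$, $\tau\ne0$, be a point such that $f(\tau)=f(0)$. Define $$g=\frac{1-2g_1}{g_1^2+(1-g_1)^2}\in(-1,1),\qquad \tilde\tau=\frac TK\left|\mathrm{sn}^{-1}(g,k)\right|=\frac{T}{K}\left|\int_0^g\frac{dt}{\sqrt{1-t^2}\sqrt{1-k^2t^2}}\right|.$$ Then $0<\tilde\tau<T$ and $|\tau|\ge\tilde\tau$.
   Context: $R_{T,B}\subset\mathbb C$ is the open rectangle $\{z: |\mathrm{Re}\,z|<T,\ |\mathrm{Im}\,z|<B\}$. $\mathbb A_{M,T,B}$ is the set of functions $f$ analytic in $R_{T,B}$, real valued on $(-T,T)$, with $|f(z)|<M$ for all $z\in R_{T,B}$. Let $q=e^{-\pi B/T}$, $\theta_2(0,q)=2\sum_{n\ge0}q^{(n+1/2)^2}$, $\theta_3(0,q)=1+2\sum_{n\ge1}q^{n^2}$, $K=\frac{\pi}{2}\theta_3(0,q)^2$ and $k=\theta_2(0,q)^2/\theta_3(0,q)^2\in(0,1)$; $\mathrm{sn}(\cdot,k)$ is the Jacobi elliptic function of modulus $k$, and $\Phi(z)=\frac{2\,\mathrm{sn}(Kz/T,k)}{1-\mathrm{sn}(Kz/T,k)}$,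 which maps $R_{T,B}$ into $\mathbb H=\mathbb C\setminus(-\infty,-1]$. Every $f\in\mathbb A_{M,T,B}$ admits a $g$-fraction representation $$f(z)=M\left(1-\frac{2}{\mu_0\sqrt{1+\Phi(z)}\,\{g_1,g_2,\dots\mid\Phi(z)\}+1}\right),\quad z\in R_{T,B},$$ with $\mu_0>0$, $g_i\in[0,1]$, where $$\{g_1,g_2,\dots\mid w\}=\cfrac{1}{1+\cfrac{g_1w}{1+\cfrac{(1-g_1)g_2w}{1+\cfrac{(1-g_2)g_3w}{1+\cdots}}}},\quad w\in\mathbb H .$$ The coefficient $g_1$ in this representation is the one given by the explicit formula in the claim. $\mathbb A^{(k)}_{M,T,B}\subset\mathbb A_{M,T,B}$ (here $k=1,2,\dots$ is an index) is the set of functions for which this representation satisfies $g_i\notin\{0,1\}$ for all $i=1,\dots,k$. *)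

(* Defs.v *)
From Stdlib Require Import Reals Lra ClassicalEpsilon.
From Coquelicot Require Import Coquelicot.
Open Scope R_scope.

Definition Csin (z : C) : C := (sin (Re z) * cosh (Im z), cos (Re z) * sinh (Im z)).
Definition Ccos (z : C) : C := (cos (Re z) * cosh (Im z), - (sin (Re z) * sinh (Im z))).

(* Principal branch: positive real part off the half-line (-oo, 0]. *)
Definition Csqrt (z : C) : C :=
  (sqrt ((Cmod z + Re z) / 2),
   (if Rle_dec 0 (Im z) then 1 else -1) * sqrt ((Cmod z - Re z) / 2)).

Definition CSeries (a : nat -> C) : C :=
  (Series (fun n => Re (a n)), Series (fun n => Im (a n))).

(* Theta functions of nome q in (0,1): theta2_0 q = theta_2(0,q) and
   theta3_0 q = theta_3(0,q) are real, theta1 and theta4 take a complex argument. *)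
Definition theta2_0 (q : R) : R := 2 * Series (fun n => Rpower q ((INR n + / 2) ^ 2)).
Definition theta3_0 (q : R) : R := 1 + 2 * Series (fun n => q ^ (S n * S n)).
Definition theta1 (q : R) (z : C) : C :=
  (2 * CSeries (fun n => RtoC ((-1) ^ n * Rpower q ((INR n + / 2) ^ 2))
                         * Csin (RtoC (INR (2 * n + 1)) * z)))%C.
Definition theta4 (q : R) (z : C) : C :=
  (1 + 2 * CSeries (fun n => RtoC ((-1) ^ (S n) * q ^ (S n * S n))
                             * Ccos (RtoC (INR (2 * S n)) * z)))%C.

Definition nome (T B : R) : R := exp (- PI * B / T).
Definition quarter_period (q : R) : R := PI / 2 * theta3_0 q ^ 2.
Definition modulus (q : R) : R := theta2_0 q ^ 2 / theta3_0 q ^ 2.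

(* The Jacobi function sn(u,k) of modulus k = modulus q, by its classical definition
   as a theta quotient (DLMF 22.2.4):
     sn(u,k) = theta_3(0) theta_1(zeta) / (theta_2(0) theta_4(zeta)),
     zeta = pi u / (2 K). *)
Definition sn (q : R) (u : C) : C :=
  let zeta := (RtoC (PI / (2 * quarter_period q)) * u)%C in
  (RtoC (theta3_0 q / theta2_0 q) * (theta1 q zeta / theta4 q zeta))%C.

(* Principal real inverse of sn(.,k), with values in [-K,K]. *)
Definition arcsn (q x : R) : R :=
  epsilon (inhabits 0)
    (fun y => - quarter_period q <= y <= quarter_period q
              /\ sn q (RtoC y) = RtoC x).

Definition rect (T B : R) (z : C) : Prop := Rabs (Re z) < T /\ Rabs (Im z) < B.

Definition Phi (T B : R) (z : C) : C :=
  let q := nome T B in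
  let s := sn q (RtoC (quarter_period q / T) * z)%C in
  (2 * s / (1 - s))%C.

(* A is the class of analytic (complex differentiable) functions on the open
   rectangle; a member is a total function, constrained only on the rectangle. *)
Definition class_A (M T B : R) (f : C -> C) : Prop :=
  (forall z, rect T B z ->
     ex_derive (K := C_AbsRing) (V := C_NormedModule) f z)
  /\ (forall x : R, - T < x < T -> Im (f (RtoC x)) = 0)
  /\ (forall z, rect T B z -> Cmod (f z) < M).

(* Coefficients are g 1, g 2, ...; the value g 0 is never used.  The i-th partial
   numerator of the continued fraction is gfrac_coef g i * w. *)
Definition gfrac_coef (g : nat -> R) (i : nat) : R :=
  match i with
  | O => 0
  | S O => g 1%nat
  | S j => (1 - g j) * g i
  end.

(* gfrac_denom g w n i = 1 + a_i w / (1 + a_(i+1) w / (... / (1 + a_(i+n-1) w))),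
   with a_i = gfrac_coef g i; it equals 1 when n = 0. *)
Fixpoint gfrac_denom (g : nat -> R) (w : C) (n i : nat) : C :=
  match n with
  | O => RtoC 1
  | S m => (1 + RtoC (gfrac_coef g i) * w / gfrac_denom g w m (S i))%C
  end.

(* The infinite continued fraction {g_1, g_2, ... | w} converges to G.  For g_i in
   [0,1] and w off (-oo,-1] no denominator vanishes. *)
Definition is_gfrac (g : nat -> R) (w G : C) : Prop :=
  filterlim (fun n => / gfrac_denom g w n 1)%C eventually
    (locally (T := C_UniformSpace) G).

Definition gfrac_representation (M T B : R) (f : C -> C) (mu0 : R) (g : nat -> R) : Prop :=
  0 < mu0
  /\ (forall i, (1 <= i)%nat -> 0 <= g i <= 1)
  /\ (forall z, rect T B z ->
        exists G : C, is_gfrac g (Phi T B z) G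
          /\ f z = (RtoC M * (1 - 2 / (RtoC mu0 * Csqrt (1 + Phi T B z) * G + 1)))%C).

Definition class_A_k (k : nat) (M T B : R) (f : C -> C) : Prop :=
  class_A M T B f
  /\ exists (mu0 : R) (g : nat -> R),
       gfrac_representation M T B f mu0 g
       /\ (forall i, (1 <= i <= k)%nat -> g i <> 0 /\ g i <> 1).

(* Main.v *)
Require Import Defs.
From Stdlib Require Import Reals Lra Lia ZArith List Permutation ClassicalEpsilon.
From Coquelicot Require Import Coquelicot.
Open Scope R_scope.

(** The whole argument takes place on the real axis.  For -T < x < T put
    s = sn(Kx/T), which lies in (-1,1), and W = sqrt((1+s)/(1-s)) = sqrt(1 + Phi(x)).
    With V = W {g_1, g_2, ... | W^2 - 1} the representation reads
    f(x) = M (1 - 2/(mu_0 V + 1)), a strictly increasing function of V, and V = 1 at x = 0.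

    A real g-fraction at w > -1 depends on g_2, g_3, ... only through a denominator lying
    between 1 and 1 + (1 - g_1) w ([rdenom_tail_bounds]).  This encloses V:

      W / (1 + g_1 (W^2 - 1)) <= V <= (1 + (1 - g_1) (W^2 - 1)) / W.

    Two consequences follow.  First, f minus the function built from the lower bound has a
    minimum at 0, which computes f'(0) and identifies the coefficient g_1 with the formula of
    the theorem ([gfrac_representation_derive]).  Secondly, f(tau) = f(0) means V = 1 at tau,
    so that W <= 1 + g_1 (W^2 - 1) and W <= 1 + (1 - g_1) (W^2 - 1); for W <> 1 these say
    exactly that |s| = |W^2 - 1| / (W^2 + 1) is at least |g| ([gfrac_gap]).  Since sn is odd
    and increasing on (-K,K), |K tau / T| >= |arcsn g|.

    The rest is real theory of sn, developed from the theta series.  Summing over the lattice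
    Z^2 along the coordinates m + n and m - n gives the products theta_3 theta_3 and
    theta_2 theta_2 in terms of theta functions of the squared nome ([th3_mul_th3],
    [th2_mul_th2]).  All else is deduced from these two identities: the relations
    cn^2 = 1 - sn^2 and dn^2 = 1 - k^2 sn^2, a difference formula for theta_1 / theta_4 which
    gives sn' = cn dn, and, by passing from the nome r^2 to the nome r, statements which are
    evident for small nome ([nome_induction]): the positivity of theta_3, of theta_2 on
    (-pi/2, pi/2), and theta_1'(0) = theta_2(0) theta_3(0) theta_4(0). *)


(** * Unordered sums *)

Definition fsum {I : Type} (a : I -> R) (l : list I) : R := fold_right Rplus 0 (map a l).

(** Convergence along the directed set of finite subsets, represented by duplicate-free lists:
    this makes reindexing by a bijection immediate. *)
Definition has_sum {I : Type} (a : I -> R) (s : R) : Prop :=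
  forall eps, 0 < eps -> exists l0, NoDup l0 /\
    forall l, NoDup l -> incl l0 l -> Rabs (fsum a l - s) < eps.

Definition abs_sum {I : Type} (a : I -> R) (s : R) : Prop :=
  has_sum a s /\ exists A, has_sum (fun i => Rabs (a i)) A.

Definition dec_eq (I : Type) : forall x y : I, {x = y} + {x <> y} :=
  fun x y => excluded_middle_informative (x = y).

Lemma fsum_app {I} (a : I -> R) l m : fsum a (l ++ m) = fsum a l + fsum a m.
Proof. induction l as [|x l IH]; unfold fsum in *; simpl; [ring|rewrite IH; ring]. Qed.

Lemma fsum_perm {I} (a : I -> R) l m : Permutation l m -> fsum a l = fsum a m.
Proof. unfold fsum; induction 1; simpl; lra. Qed.

Lemma fsum_map {I J} (a : I -> R) (f : J -> I) l : fsum a (map f l) = fsum (fun j => a (f j)) l.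
Proof. unfold fsum; now rewrite map_map. Qed.

Lemma fsum_ext {I} (a b : I -> R) l : (forall i, a i = b i) -> fsum a l = fsum b l.
Proof. intros H; unfold fsum; now rewrite (map_ext a b H). Qed.

Lemma fsum_plus {I} (a b : I -> R) l : fsum (fun i => a i + b i) l = fsum a l + fsum b l.
Proof. induction l; unfold fsum in *; simpl; lra. Qed.

Lemma fsum_scal {I} c (a : I -> R) l : fsum (fun i => c * a i) l = c * fsum a l.
Proof. induction l as [|x l IH]; unfold fsum in *; simpl; [ring|rewrite IH; ring]. Qed.

Lemma fsum_abs {I} (a : I -> R) l : Rabs (fsum a l) <= fsum (fun i => Rabs (a i)) l.
Proof.
  induction l as [|x l IH]; unfold fsum in *; simpl; [rewrite Rabs_R0; lra|].
  eapply Rle_trans; [apply Rabs_triang|lra].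
Qed.

Lemma fsum_prod {I J} (a : I -> R) (b : J -> R) l m :
  fsum (fun p => a (fst p) * b (snd p)) (list_prod l m) = fsum a l * fsum b m.
Proof.
  induction l as [|x l IH]; simpl; [unfold fsum; simpl; ring|].
  rewrite fsum_app, IH, fsum_map. simpl. rewrite fsum_scal. unfold fsum; simpl; ring.
Qed.

Lemma incl_complement {I} (l m : list I) :
  NoDup l -> NoDup m -> incl l m -> exists r, Permutation m (l ++ r).
Proof.
  intros Hl Hm Hi.
  exists (filter (fun x => if in_dec (dec_eq I) x l then false else true) m).
  apply NoDup_Permutation; trivial.
  - apply NoDup_app; trivial.
    + now apply NoDup_filter.
    + intros x H1 H2. apply filter_In in H2. destruct (in_dec (dec_eq I) x l); easy.
  - intros x. rewrite in_app_iff, filter_In. destruct (in_dec (dec_eq I) x l); split; intuition.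
Qed.

(** The terms of [l3] outside [l2] are among those outside [l1].  Comparing an arbitrary finite
    set with two boxes in this way is what the convergence of products and series rests on. *)
Lemma fsum_sandwich {I} (a : I -> R) l1 l2 l3 :
  NoDup l1 -> NoDup l2 -> NoDup l3 -> incl l1 l2 -> incl l2 l3 ->
  Rabs (fsum a l3 - fsum a l2)
    <= fsum (fun i => Rabs (a i)) l3 - fsum (fun i => Rabs (a i)) l1.
Proof.
  intros N1 N2 N3 H12 H23.
  destruct (incl_complement _ _ N1 N2 H12) as [r P].
  destruct (incl_complement _ _ N2 N3 H23) as [r' P'].
  rewrite (fsum_perm _ _ _ P'), (fsum_perm (fun i => Rabs (a i)) _ _ P'), !fsum_app.
  rewrite (fsum_perm (fun i => Rabs (a i)) _ _ P), !fsum_app.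
  pose proof (fsum_abs a r'). pose proof (fsum_abs a r). pose proof (Rabs_pos (fsum a r)).
  replace (fsum a l2 + fsum a r' - fsum a l2) with (fsum a r') by ring. lra.
Qed.

Lemma has_sum_unique {I} (a : I -> R) s t : has_sum a s -> has_sum a t -> s = t.
Proof.
  intros Hs Ht.
  apply cond_eq. intros eps Heps.
  destruct (Hs (eps / 2)) as [l [_ Hl]]; [lra|]. destruct (Ht (eps / 2)) as [m [_ Hm]]; [lra|].
  set (n := nodup (dec_eq I) (l ++ m)).
  assert (Nn : NoDup n) by apply NoDup_nodup.
  assert (L : incl l n) by (intros x Hx; apply nodup_In, in_or_app; now left).
  assert (M : incl m n) by (intros x Hx; apply nodup_In, in_or_app; now right).
  specialize (Hl n Nn L). specialize (Hm n Nn M).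
  apply Rabs_def2 in Hl. apply Rabs_def2 in Hm. apply Rabs_def1; lra.
Qed.

Lemma has_sum_ext {I} (a b : I -> R) s : (forall i, a i = b i) -> has_sum a s -> has_sum b s.
Proof.
  intros E H eps Heps. destruct (H eps Heps) as [l [N Hl]]. exists l; split; trivial.
  intros m Nm Hm. rewrite <- (fsum_ext a b m E). now apply Hl.
Qed.

Lemma has_sum_plus {I} (a b : I -> R) s t :
  has_sum a s -> has_sum b t -> has_sum (fun i => a i + b i) (s + t).
Proof.
  intros Ha Hb eps Heps.
  destruct (Ha (eps / 2)) as [l [Nl Hl]]; [lra|]. destruct (Hb (eps / 2)) as [m [Nm Hm]]; [lra|].
  exists (nodup (dec_eq I) (l ++ m)). split; [apply NoDup_nodup|].
  intros n Nn Hn. rewrite fsum_plus.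
  assert (L : incl l n) by (intros x Hx; apply Hn, nodup_In, in_or_app; now left).
  assert (M : incl m n) by (intros x Hx; apply Hn, nodup_In, in_or_app; now right).
  specialize (Hl n Nn L). specialize (Hm n Nn M).
  apply Rabs_def2 in Hl. apply Rabs_def2 in Hm. apply Rabs_def1; lra.
Qed.

Lemma has_sum_scal {I} c (a : I -> R) s : has_sum a s -> has_sum (fun i => c * a i) (c * s).
Proof.
  intros Ha eps Heps.
  assert (Hc : 0 < Rabs c + 1) by (pose proof (Rabs_pos c); lra).
  destruct (Ha (eps / (Rabs c + 1))) as [l [Nl Hl]]; [now apply Rdiv_lt_0_compat|].
  exists l; split; trivial. intros m Nm Hm. rewrite fsum_scal.
  replace (c * fsum a m - c * s) with (c * (fsum a m - s)) by ring. rewrite Rabs_mult.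
  specialize (Hl m Nm Hm). pose proof (Rabs_pos c). pose proof (Rabs_pos (fsum a m - s)).
  apply Rle_lt_trans with ((Rabs c + 1) * Rabs (fsum a m - s)); [nra|].
  replace eps with ((Rabs c + 1) * (eps / (Rabs c + 1))) by (field; lra).
  now apply Rmult_lt_compat_l.
Qed.

Lemma has_sum_reindex {I J} (a : I -> R) (f : J -> I) (g : I -> J) s :
  (forall i, f (g i) = i) -> (forall j, g (f j) = j) ->
  has_sum a s -> has_sum (fun j => a (f j)) s.
Proof.
  intros fg gf H eps Heps. destruct (H eps Heps) as [l [Nl Hl]].
  exists (map g l). split.
  - apply FinFun.Injective_map_NoDup; trivial. intros x y E. now rewrite <- (fg x), <- (fg y), E.
  - intros m Nm Hm. rewrite <- (fsum_map a f). apply Hl.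
    + apply FinFun.Injective_map_NoDup; trivial. intros x y E. now rewrite <- (gf x), <- (gf y), E.
    + intros i Hi. rewrite <- (fg i). apply in_map, Hm. now apply in_map.
Qed.

Lemma list_preimage {I J} (f : J -> I) (g : I -> J) (l : list I) :
  (forall i, In i l -> f (g i) = i) -> map f (map g l) = l.
Proof.
  intros H. rewrite map_map. rewrite <- (map_id l) at 2. now apply map_ext_in.
Qed.

(** The index set is split by [p] into the images of two injections [f] and [f'], whose inverses
    are [g] and [g']. *)
Lemma has_sum_union {I J K} (a : I -> R) (f : J -> I) (f' : K -> I)
  (g : I -> J) (g' : I -> K) (p : I -> bool) s t :
  (forall j, g (f j) = j) -> (forall k, g' (f' k) = k) ->
  (forall i, p i = true -> f (g i) = i) -> (forall i, p i = false -> f' (g' i) = i) ->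
  (forall j, p (f j) = true) -> (forall k, p (f' k) = false) ->
  has_sum (fun j => a (f j)) s -> has_sum (fun k => a (f' k)) t -> has_sum a (s + t).
Proof.
  intros gf gf' fg fg' pf pf' Hs Ht eps Heps.
  destruct (Hs (eps / 2)) as [l [Nl Hl]]; [lra|]. destruct (Ht (eps / 2)) as [m [Nm Hm]]; [lra|].
  assert (injf : forall x y, f x = f y -> x = y)
    by (intros x y E; rewrite <- (gf x), <- (gf y), E; trivial).
  assert (injf' : forall x y, f' x = f' y -> x = y)
    by (intros x y E; rewrite <- (gf' x), <- (gf' y), E; trivial).
  exists (map f l ++ map f' m). split.
  { apply NoDup_app.
    - apply FinFun.Injective_map_NoDup; trivial.
    - apply FinFun.Injective_map_NoDup; trivial.
    - intros x H1 H2. apply in_map_iff in H1. apply in_map_iff in H2.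
      destruct H1 as [j [<- _]]. destruct H2 as [k [E _]].
      pose proof (pf j). pose proof (pf' k). congruence. }
  intros n Nn Hn.
  set (n1 := filter p n). set (n2 := filter (fun i => negb (p i)) n).
  assert (P : Permutation n (n1 ++ n2)).
  { apply NoDup_Permutation; trivial.
    - apply NoDup_app; [now apply NoDup_filter|now apply NoDup_filter|].
      intros x H1 H2. apply filter_In in H1. apply filter_In in H2.
      destruct H1 as [_ H1], H2 as [_ H2]. rewrite H1 in H2. discriminate.
    - intros x. unfold n1, n2. rewrite in_app_iff, !filter_In.
      destruct (p x); simpl; intuition. }
  rewrite (fsum_perm _ _ _ P), fsum_app.
  assert (E1 : map f (map g n1) = n1).
  { apply list_preimage. intros i Hi. apply filter_In in Hi. now apply fg. }
  assert (E2 : map f' (map g' n2) = n2).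
  { apply list_preimage. intros i Hi. apply filter_In in Hi. apply fg'.
    destruct Hi as [_ Hi]. now destruct (p i). }
  rewrite <- E1, <- E2, (fsum_map a f), (fsum_map a f').
  assert (A : Rabs (fsum (fun j => a (f j)) (map g n1) - s) < eps / 2).
  { apply Hl.
    - apply (NoDup_map_inv f). rewrite E1. now apply NoDup_filter.
    - intros j Hj. rewrite <- (gf j). apply in_map. apply filter_In. split; trivial.
      apply Hn, in_or_app. left. now apply in_map. }
  assert (B : Rabs (fsum (fun j => a (f' j)) (map g' n2) - t) < eps / 2).
  { apply Hm.
    - apply (NoDup_map_inv f'). rewrite E2. now apply NoDup_filter.
    - intros j Hj. rewrite <- (gf' j). apply in_map. apply filter_In. split.
      + apply Hn, in_or_app. right. now apply in_map.
      + now rewrite pf'. }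
  apply Rabs_def2 in A. apply Rabs_def2 in B. apply Rabs_def1; lra.
Qed.

Lemma NoDup_list_prod {I J} (l : list I) (m : list J) :
  NoDup l -> NoDup m -> NoDup (list_prod l m).
Proof.
  intros Hl Hm. induction Hl as [|x l Hx Hl IH]; simpl; [constructor|].
  apply NoDup_app; trivial.
  - apply FinFun.Injective_map_NoDup; trivial. intros u v E. now injection E.
  - intros [u v] H1 H2. apply in_map_iff in H1. destruct H1 as [w [E _]].
    injection E as <- _. apply in_prod_iff in H2. now destruct H2.
Qed.

(** A finite set of pairs which contains a large box is itself contained in a larger box, and
    over boxes the sum of products is the product of the sums; the difference is controlled by
    the absolute sums. *)
Lemma has_sum_prod {I J} (a : I -> R) (b : J -> R) s t :
  abs_sum a s -> abs_sum b t -> has_sum (fun p => a (fst p) * b (snd p)) (s * t).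
Proof.
  intros [Ha [A HA]] [Hb [B HB]] eps Heps.
  set (D := 2 * (Rabs A + Rabs B + 2) + Rabs s + Rabs t + 2).
  assert (HD : 0 < D).
  { unfold D. pose proof (Rabs_pos A). pose proof (Rabs_pos B).
    pose proof (Rabs_pos s). pose proof (Rabs_pos t). lra. }
  (* [d] <= 1 linearizes the products of errors; their coefficients in [d] add up to less than [D]. *)
  set (d := Rmin 1 (eps / D)).
  assert (Hd : 0 < d) by (apply Rmin_pos; [lra|now apply Rdiv_lt_0_compat]).
  assert (Hd1 : d <= 1) by apply Rmin_l.
  assert (HdD : D * d <= eps).
  { apply Rle_trans with (D * (eps / D)); [|right; field; lra].
    apply Rmult_le_compat_l; [lra|apply Rmin_r]. }
  destruct (Ha d Hd) as [l1 [_ Hl1]]. destruct (HA d Hd) as [l2 [_ Hl2]].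
  destruct (Hb d Hd) as [m1 [_ Hm1]]. destruct (HB d Hd) as [m2 [_ Hm2]].
  set (l0 := nodup (dec_eq I) (l1 ++ l2)). set (m0 := nodup (dec_eq J) (m1 ++ m2)).
  assert (Nl0 : NoDup l0) by apply NoDup_nodup.
  assert (Nm0 : NoDup m0) by apply NoDup_nodup.
  exists (list_prod l0 m0). split; [now apply NoDup_list_prod|].
  intros L NL HL.
  set (l := nodup (dec_eq I) (l0 ++ map fst L)). set (m := nodup (dec_eq J) (m0 ++ map snd L)).
  assert (Nl : NoDup l) by apply NoDup_nodup.
  assert (Nm : NoDup m) by apply NoDup_nodup.
  assert (Il : incl l0 l) by (intros x Hx; apply nodup_In, in_or_app; now left).
  assert (Im : incl m0 m) by (intros x Hx; apply nodup_In, in_or_app; now left).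
  assert (I1 : incl l1 l0) by (intros x Hx; apply nodup_In, in_or_app; now left).
  assert (I2 : incl l2 l0) by (intros x Hx; apply nodup_In, in_or_app; now right).
  assert (J1 : incl m1 m0) by (intros x Hx; apply nodup_In, in_or_app; now left).
  assert (J2 : incl m2 m0) by (intros x Hx; apply nodup_In, in_or_app; now right).
  assert (IL : incl L (list_prod l m)).
  { intros [x y] Hxy. apply in_prod; apply nodup_In, in_or_app; right.
    - apply (in_map fst _ _ Hxy).
    - apply (in_map snd _ _ Hxy). }
  pose proof (fsum_sandwich (fun p => a (fst p) * b (snd p)) _ _ _
    (NoDup_list_prod _ _ Nl0 Nm0) NL (NoDup_list_prod _ _ Nl Nm) HL IL) as S.
  rewrite !(fsum_ext (fun p => Rabs (a (fst p) * b (snd p)))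
    (fun p => Rabs (a (fst p)) * Rabs (b (snd p)))) in S by (intros; apply Rabs_mult).
  rewrite (fsum_prod a b), !(fsum_prod (fun i => Rabs (a i)) (fun j => Rabs (b j))) in S.
  specialize (Hl1 l Nl (incl_tran I1 Il)). specialize (Hm1 m Nm (incl_tran J1 Im)).
  pose proof (Hl2 l Nl (incl_tran I2 Il)) as U1. pose proof (Hm2 m Nm (incl_tran J2 Im)) as V1.
  pose proof (Hl2 l0 Nl0 I2) as U0. pose proof (Hm2 m0 Nm0 J2) as V0.
  revert S Hl1 Hm1 U1 V1 U0 V0.
  generalize (fsum a l), (fsum b m), (fsum (fun i => Rabs (a i)) l), (fsum (fun i => Rabs (b i)) m),
    (fsum (fun i => Rabs (a i)) l0), (fsum (fun i => Rabs (b i)) m0),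
    (fsum (fun p => a (fst p) * b (snd p)) L).
  intros al bm Al Bm A0 B0 F S Hal Hbm U1 V1 U0 V0.
  assert (X : Rabs (al * bm - s * t) <= d * (Rabs s + Rabs t + 1)).
  { replace (al * bm - s * t) with ((al - s) * (bm - t) + s * (bm - t) + t * (al - s)) by ring.
    eapply Rle_trans; [apply Rabs_triang|]. eapply Rle_trans;
      [apply Rplus_le_compat_r, Rabs_triang|]. rewrite !Rabs_mult.
    pose proof (Rabs_pos s). pose proof (Rabs_pos t).
    pose proof (Rabs_pos (al - s)). pose proof (Rabs_pos (bm - t)). nra. }
  assert (Y : Al * Bm - A0 * B0 <= 2 * d * (Rabs A + Rabs B + 2)).
  { apply Rabs_def2 in U1. apply Rabs_def2 in V1. apply Rabs_def2 in U0. apply Rabs_def2 in V0.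
    replace (Al * Bm - A0 * B0) with ((Al - A0) * Bm + A0 * (Bm - B0)) by ring.
    assert (H1 : Rabs ((Al - A0) * Bm) <= 2 * d * (Rabs B + 1)).
    { rewrite Rabs_mult. apply Rmult_le_compat; try apply Rabs_pos.
      - apply Rabs_le; lra.
      - apply Rabs_le. pose proof (Rle_abs B). pose proof (Rabs_maj2 B). lra. }
    assert (H2 : Rabs (A0 * (Bm - B0)) <= (Rabs A + 1) * (2 * d)).
    { rewrite Rabs_mult. apply Rmult_le_compat; try apply Rabs_pos.
      - apply Rabs_le. pose proof (Rle_abs A). pose proof (Rabs_maj2 A). lra.
      - apply Rabs_le; lra. }
    pose proof (Rle_abs ((Al - A0) * Bm)). pose proof (Rle_abs (A0 * (Bm - B0))).
    lra. }
  replace (F - s * t) with (- (al * bm - F) + (al * bm - s * t)) by ring.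
  eapply Rle_lt_trans; [apply Rabs_triang|]. rewrite Rabs_Ropp.
  unfold D in HdD. nra.
Qed.

Lemma fsum_seq (a : nat -> R) n : fsum a (seq 0 (S n)) = sum_n a n.
Proof.
  induction n as [|n IH]; [unfold fsum; rewrite sum_O; simpl; ring|].
  rewrite seq_S, fsum_app, IH, sum_Sn. unfold fsum, plus; simpl. ring.
Qed.

Lemma has_sum_series (a : nat -> R) :
  ex_series (fun n => Rabs (a n)) -> has_sum a (Series a).
Proof.
  intros Hex eps Heps.
  pose proof (Series_correct _ (ex_series_Rabs _ Hex)) as Ha.
  pose proof (Series_correct _ Hex) as HA.
  set (A := Series (fun n => Rabs (a n))) in *.
  apply (is_lim_seq_spec (sum_n a) (Finite _)) in Ha.
  apply (is_lim_seq_spec (sum_n (fun n => Rabs (a n))) (Finite _)) in HA.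
  set (e := mkposreal (eps / 4) ltac:(lra)).
  destruct (Ha e) as [N1 H1]. destruct (HA e) as [N2 H2].
  set (N := max N1 N2).
  exists (seq 0 (S N)). split; [apply seq_NoDup|].
  intros l Nl Hl.
  set (M := max N (list_max l)).
  assert (HM : incl l (seq 0 (S M))).
  { intros x Hx. apply in_seq. pose proof (proj1 (list_max_le l (list_max l)) (Nat.le_refl _)) as F.
    rewrite Forall_forall in F. specialize (F x Hx). lia. }
  pose proof (fsum_sandwich a _ _ _ (seq_NoDup _ _) Nl (seq_NoDup _ _) Hl HM) as S1.
  rewrite !fsum_seq in S1.
  specialize (H1 M ltac:(lia)).
  pose proof (H2 M ltac:(lia)) as H2M. specialize (H2 N ltac:(lia)).
  simpl in H1, H2, H2M.
  apply Rabs_def2 in H1. apply Rabs_def2 in H2. apply Rabs_def2 in H2M.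
  apply Rabs_def1; apply Rabs_le_between in S1; lra.
Qed.

(** The integers are folded along n <-> -1-n, which is the symmetry n + 1/2 <-> -(n + 1/2) of
    the exponents of theta_2. *)
Lemma has_sum_Z (a : Z -> R) s t :
  has_sum (fun n : nat => a (Z.of_nat n)) s ->
  has_sum (fun n : nat => a (- 1 - Z.of_nat n)%Z) t -> has_sum a (s + t).
Proof.
  apply (has_sum_union a Z.of_nat (fun n => (- 1 - Z.of_nat n)%Z) Z.to_nat
           (fun z => Z.to_nat (- 1 - z)) (fun z => Z.leb 0 z)); intros.
  - lia.
  - lia.
  - apply Z.leb_le in H. lia.
  - apply Z.leb_gt in H. lia.
  - apply Z.leb_le. lia.
  - apply Z.leb_gt. lia.
Qed.

(** Pairs with even coordinate sum are (a + b, a - b), those with odd sum (a + b + 1, a - b). *)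
Lemma has_sum_lattice (c : Z * Z -> R) s t :
  has_sum (fun p => c (fst p + snd p, fst p - snd p)%Z) s ->
  has_sum (fun p => c (fst p + snd p + 1, fst p - snd p)%Z) t -> has_sum c (s + t).
Proof.
  apply (has_sum_union c (fun p => (fst p + snd p, fst p - snd p)%Z)
    (fun p => (fst p + snd p + 1, fst p - snd p)%Z)
    (fun p => ((fst p + snd p) / 2, (fst p - snd p) / 2)%Z)
    (fun p => ((fst p + snd p - 1) / 2, (fst p - snd p - 1) / 2)%Z)
    (fun p => Z.even (fst p + snd p))).
  - intros [a b]; simpl. f_equal; [replace (a + b + (a - b))%Z with (a * 2)%Z by ring
     |replace (a + b - (a - b))%Z with (b * 2)%Z by ring]; apply Z.div_mul; lia.
  - intros [a b]; simpl. f_equal; [replace (a + b + 1 + (a - b) - 1)%Z with (a * 2)%Z by ring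
     |replace (a + b + 1 - (a - b) - 1)%Z with (b * 2)%Z by ring]; apply Z.div_mul; lia.
  - intros [m n]; simpl. intros H. apply Z.even_spec in H. destruct H as [k Hk].
    replace (m + n)%Z with (k * 2)%Z by lia. replace (m - n)%Z with ((k - n) * 2)%Z by lia.
    rewrite !Z.div_mul by lia. f_equal; lia.
  - intros [m n]; simpl. intros H. rewrite <- Z.negb_odd in H.
    assert (H' : Z.odd (m + n) = true) by (destruct (Z.odd (m + n)); easy).
    apply Z.odd_spec in H'. destruct H' as [k Hk].
    replace (m + n - 1)%Z with (k * 2)%Z by lia.
    replace (m - n - 1)%Z with ((k - n) * 2)%Z by lia.
    rewrite !Z.div_mul by lia. f_equal; lia.
  - intros [a b]; simpl. apply Z.even_spec. exists a. ring.
  - intros [a b]; simpl. rewrite <- Z.negb_odd.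
    replace (Z.odd _) with true; trivial. symmetry. apply Z.odd_spec. exists a. ring.
Qed.

(** * Theta series as sums over the integers and their product formulas *)

Lemma Rpower_gauss_le q x n : 0 < q < 1 -> INR n <= x -> Rpower q (x ^ 2) <= q ^ n.
Proof.
  intros Hq Hx. rewrite <- (Rpower_pow n q) by lra.
  assert (Hn : INR n <= x ^ 2).
  { apply Rle_trans with (INR n ^ 2); [|apply pow_incr; split; [apply pos_INR|trivial]].
    simpl; rewrite Rmult_1_r, <- mult_INR. apply le_INR. nia. }
  unfold Rpower. assert (ln q < 0) by (rewrite <- ln_1; apply ln_increasing; lra).
  destruct (Req_dec (x ^ 2) (INR n)) as [->|D]; [lra|].
  left. apply exp_increasing. nra.
Qed.

(** Every theta series is dominated by the geometric series of ratio [q]. *)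
Lemma ex_series_gauss q (x t : nat -> R) : 0 < q < 1 -> (forall n, INR n <= x n) ->
  (forall n, Rabs (t n) <= 1) -> ex_series (fun n => Rabs (Rpower q (x n ^ 2) * t n)).
Proof.
  intros Hq Hx Ht. apply (ex_series_le (V := R_CompleteNormedModule)) with (fun n => q ^ n).
  - intros n. change (norm ?y) with (Rabs y). rewrite Rabs_Rabsolu, Rabs_mult.
    assert (P : 0 < Rpower q (x n ^ 2)) by apply exp_pos.
    rewrite (Rabs_pos_eq (Rpower _ _)) by lra.
    pose proof (Rpower_gauss_le q (x n) n Hq (Hx n)). specialize (Ht n).
    pose proof (Rabs_pos (t n)). nra.
  - apply ex_series_geom. rewrite Rabs_pos_eq; lra.
Qed.

(** The sum over all integers n of q^((n+e)^2) cos(2(n+e)z), folded along n <-> -1-n: it is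
    theta_3 for e = 0 and theta_2 for e = 1/2. *)
Definition theta_cos (e q z : R) : R :=
  Series (fun n => Rpower q ((INR n + e) ^ 2) * cos (2 * (INR n + e) * z))
  + Series (fun n => Rpower q ((INR n + 1 - e) ^ 2) * cos (2 * (INR n + 1 - e) * z)).

Lemma abs_sum_gauss q e (t : R -> R) : 0 < q < 1 -> 0 <= e <= / 2 -> (forall x, Rabs (t x) <= 1) ->
  abs_sum (fun n : Z => Rpower q ((IZR n + e) ^ 2) * t (IZR n + e))
    (Series (fun n => Rpower q ((INR n + e) ^ 2) * t (INR n + e))
     + Series (fun n => Rpower q ((INR n + 1 - e) ^ 2) * t (- (INR n + 1 - e)))).
Proof.
  intros Hq He Ht.
  assert (H1 := ex_series_gauss q (fun n => INR n + e) (fun n => t (INR n + e)) Hq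
    ltac:(intros; lra) ltac:(intros; apply Ht)).
  assert (H2 := ex_series_gauss q (fun n => INR n + 1 - e) (fun n => t (- (INR n + 1 - e))) Hq
    ltac:(intros; lra) ltac:(intros; apply Ht)).
  assert (E : forall n, IZR (- 1 - Z.of_nat n) + e = - (INR n + 1 - e)).
  { intros n. rewrite minus_IZR, <- INR_IZR_INZ. ring. }
  split; [|eexists]; apply has_sum_Z.
  - apply has_sum_ext with (2 := has_sum_series _ H1). intros n. now rewrite <- INR_IZR_INZ.
  - apply has_sum_ext with (2 := has_sum_series _ H2). intros n. rewrite E. do 2 f_equal. ring.
  - assert (H1' := H1). apply ex_series_ext with (b := fun n => Rabs (Rabs (Rpower q ((INR n + e) ^ 2) * t (INR n + e)))) in H1'.
    2: intros; now rewrite Rabs_Rabsolu.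
    apply has_sum_ext with (2 := has_sum_series _ H1'). intros n. now rewrite <- INR_IZR_INZ.
  - assert (H2' := H2). apply ex_series_ext with (b := fun n => Rabs (Rabs (Rpower q ((INR n + 1 - e) ^ 2) * t (- (INR n + 1 - e))))) in H2'.
    2: intros; now rewrite Rabs_Rabsolu.
    apply has_sum_ext with (2 := has_sum_series _ H2'). intros n. rewrite E. do 3 f_equal. ring.
Qed.

Lemma abs_sum_cos q e z : 0 < q < 1 -> 0 <= e <= / 2 ->
  abs_sum (fun n : Z => Rpower q ((IZR n + e) ^ 2) * cos (2 * (IZR n + e) * z)) (theta_cos e q z).
Proof.
  intros Hq He. pose proof (abs_sum_gauss q e (fun x => cos (2 * x * z)) Hq He) as H.
  unfold theta_cos. rewrite (Series_ext (fun n => Rpower q ((INR n + 1 - e) ^ 2) * _)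
    (fun n => Rpower q ((INR n + 1 - e) ^ 2) * cos (2 * - (INR n + 1 - e) * z))).
  - apply H. intros x. apply Rabs_le, COS_bound.
  - intros n. f_equal. rewrite <- cos_neg. f_equal. ring.
Qed.

(** The exponents n + e are symmetric about 0 precisely for these two values of e, and the sine
    is odd.  This lets products of cosine series be written with the cosine of a sum. *)
Lemma abs_sum_sin q e z : 0 < q < 1 -> e = 0 \/ e = / 2 ->
  abs_sum (fun n : Z => Rpower q ((IZR n + e) ^ 2) * sin (2 * (IZR n + e) * z)) 0.
Proof.
  intros Hq He. pose proof (abs_sum_gauss q e (fun x => sin (2 * x * z)) Hq ltac:(lra)) as H.
  match type of H with _ -> abs_sum _ ?s => replace 0 with s end.
  { apply H. intros x. apply Rabs_le, SIN_bound. }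
  rewrite (Series_ext (fun n => Rpower q ((INR n + 1 - e) ^ 2) * _)
    (fun n => - (Rpower q ((INR n + 1 - e) ^ 2) * sin (2 * (INR n + 1 - e) * z)))).
  2:{ intros n. rewrite Ropp_mult_distr_r, <- sin_neg. do 2 f_equal. ring. }
  rewrite Series_opp. destruct He as [-> | ->].
  - rewrite Series_incr_1.
    + rewrite (Series_ext (fun n => Rpower q ((INR (S n) + 0) ^ 2) * _)
        (fun n => Rpower q ((INR n + 1 - 0) ^ 2) * sin (2 * (INR n + 1 - 0) * z))).
      * simpl INR. replace (2 * (0 + 0) * z) with 0 by ring. rewrite sin_0. ring.
      * intros n. rewrite S_INR. now replace (INR n + 1 + 0) with (INR n + 1 - 0) by ring.
    + apply ex_series_Rabs, (ex_series_gauss q (fun n => INR n + 0) (fun n => sin (2 * (INR n + 0) * z)));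
        trivial; intros; [lra|apply Rabs_le, SIN_bound].
  - rewrite (Series_ext (fun n => Rpower q ((INR n + 1 - / 2) ^ 2) * _)
        (fun n => Rpower q ((INR n + / 2) ^ 2) * sin (2 * (INR n + / 2) * z))); [ring|].
    intros n. now replace (INR n + 1 - / 2) with (INR n + / 2) by field.
Qed.

Definition gauss_wave (q e e' x y : R) (p : Z * Z) : R :=
  Rpower q ((IZR (fst p) + e) ^ 2 + (IZR (snd p) + e') ^ 2)
  * cos (2 * (IZR (fst p) + e) * x + 2 * (IZR (snd p) + e') * y).

Lemma has_sum_theta_prod q e e' x y : 0 < q < 1 -> e = 0 \/ e = / 2 -> e' = 0 \/ e' = / 2 ->
  has_sum (gauss_wave q e e' x y) (theta_cos e q x * theta_cos e' q y).
Proof.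
  intros Hq He He'.
  pose proof (has_sum_prod _ _ _ _ (abs_sum_cos q e x Hq ltac:(lra)) (abs_sum_cos q e' y Hq ltac:(lra))) as C.
  pose proof (has_sum_prod _ _ _ _ (abs_sum_sin q e x Hq He) (abs_sum_sin q e' y Hq He')) as S.
  replace (theta_cos e q x * theta_cos e' q y)
    with (theta_cos e q x * theta_cos e' q y + (-1) * (0 * 0)) by ring.
  apply has_sum_ext with (2 := has_sum_plus _ _ _ _ C (has_sum_scal (-1) _ _ S)).
  intros [m n]. unfold gauss_wave; simpl fst; simpl snd. rewrite Rpower_plus, cos_plus. ring.
Qed.

(** The double series of the product is summed separately over the two parity classes of m + n. *)
Lemma theta_prod_lattice r e x y s t :
  0 < r < 1 -> e = 0 \/ e = / 2 ->
  has_sum (fun p => gauss_wave r e e x y (fst p + snd p, fst p - snd p)%Z) s ->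
  has_sum (fun p => gauss_wave r e e x y (fst p + snd p + 1, fst p - snd p)%Z) t ->
  theta_cos e r x * theta_cos e r y = s + t.
Proof.
  intros Hr He Hs Ht.
  apply (has_sum_unique _ _ _ (has_sum_theta_prod r e e x y Hr He He)).
  now apply has_sum_lattice.
Qed.

Lemma Rpower_sqr r x : 0 < r -> Rpower (r ^ 2) x = Rpower r (2 * x).
Proof. intros H. rewrite <- (Rpower_pow 2) by trivial. rewrite Rpower_mult. reflexivity. Qed.

Lemma sqr_in_01 r : 0 < r < 1 -> 0 < r ^ 2 < 1.
Proof. simpl; nra. Qed.

Notation th2 := (theta_cos (/ 2)).
Notation th3 := (theta_cos 0).

(** With m = a + b and n = a - b one has m^2 + n^2 = 2(a^2 + b^2), which doubles the exponent
    and so squares the nome; pairs of odd sum have half-integers a and b instead. *)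
Lemma th3_mul_th3 r x y : 0 < r < 1 ->
  th3 r x * th3 r y
  = th3 (r ^ 2) (x + y) * th3 (r ^ 2) (x - y) + th2 (r ^ 2) (x + y) * th2 (r ^ 2) (x - y).
Proof.
  intros Hr. assert (Hq := sqr_in_01 r Hr).
  apply theta_prod_lattice; auto.
  - eapply has_sum_ext; [|apply has_sum_theta_prod; auto].
    intros [a b]. unfold gauss_wave; simpl fst; simpl snd.
    rewrite Rpower_sqr, minus_IZR, plus_IZR by lra. f_equal; f_equal; ring.
  - eapply has_sum_ext; [|apply has_sum_theta_prod; auto].
    intros [a b]. unfold gauss_wave; simpl fst; simpl snd.
    rewrite Rpower_sqr, minus_IZR, !plus_IZR by lra. f_equal; f_equal; field.
Qed.

Lemma th2_mul_th2 r x y : 0 < r < 1 ->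
  th2 r x * th2 r y
  = th2 (r ^ 2) (x + y) * th3 (r ^ 2) (x - y) + th3 (r ^ 2) (x + y) * th2 (r ^ 2) (x - y).
Proof.
  intros Hr. assert (Hq := sqr_in_01 r Hr).
  apply theta_prod_lattice; auto.
  - eapply has_sum_ext; [|apply has_sum_theta_prod; auto].
    intros [a b]. unfold gauss_wave; simpl fst; simpl snd.
    rewrite Rpower_sqr, minus_IZR, plus_IZR by lra. f_equal; f_equal; field.
  (* For odd m + n the half-integers m + 1/2 and n + 1/2 have the integer half-sum a + 1. *)
  - eapply has_sum_ext; [|apply (has_sum_reindex (gauss_wave (r ^ 2) 0 (/ 2) (x + y) (x - y)) (fun p => (fst p + 1, snd p)%Z)
      (fun p => (fst p - 1, snd p)%Z)), has_sum_theta_prod; auto].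
    + intros [a b]. unfold gauss_wave; simpl fst; simpl snd.
      rewrite Rpower_sqr, minus_IZR, !plus_IZR by lra. f_equal; f_equal; field.
    + intros [a b]; simpl; f_equal; ring.
    + intros [a b]; simpl; f_equal; ring.
Qed.

(** * Positivity of the theta functions *)

(** Repeated squaring brings every nome below [d], so a property that holds for small nomes and
    passes from [r ^ 2] to [r] holds for all of them. *)
Lemma nome_induction (d : R) (P : R -> Prop) : 0 < d ->
  (forall q, 0 < q < 1 -> q <= d -> P q) ->
  (forall r, 0 < r < 1 -> P (r ^ 2) -> P r) ->
  forall q, 0 < q < 1 -> P q.
Proof.
  intros Hd Hsmall Hlift.
  assert (A : forall n q, 0 < q < 1 -> q ^ (2 ^ n) <= d -> P q).
  { induction n as [|n IH]; intros q Hq H.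
    - apply Hsmall; trivial. simpl in H. lra.
    - apply Hlift; trivial. apply IH; [now apply sqr_in_01|].
      rewrite <- pow_mult. exact H. }
  intros q Hq.
  destruct (pow_lt_1_zero q ltac:(rewrite Rabs_pos_eq; lra) d Hd) as [N HN].
  apply (A N); trivial. left. apply Rle_lt_trans with (1 := Rle_abs _). apply HN.
  pose proof (Nat.pow_gt_lin_r 2 N). lia.
Qed.

Lemma Series_nonneg (a : nat -> R) : (forall n, 0 <= a n) -> ex_series a -> 0 <= Series a.
Proof.
  intros H Ha. replace 0 with (Series (fun n => 0 * a n)).
  - apply Series_le; trivial. intros n. specialize (H n). lra.
  - rewrite Series_scal_l. ring.
Qed.

Lemma Series_Rabs_le (a b : nat -> R) : (forall n, Rabs (a n) <= b n) -> ex_series b ->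
  Rabs (Series a) <= Series b.
Proof.
  intros H Hb.
  assert (Ha : ex_series (fun n => Rabs (a n))).
  { apply (ex_series_le (V := R_CompleteNormedModule)) with b; trivial.
    intros n. change (norm ?y) with (Rabs y). now rewrite Rabs_Rabsolu. }
  apply Rle_trans with (1 := Series_Rabs _ Ha). apply Series_le; trivial.
  intros n. split; [apply Rabs_pos|apply H].
Qed.

Lemma th3_eq q z : 0 < q < 1 ->
  th3 q z = 1 + 2 * Series (fun n => q ^ (S n * S n) * cos (2 * INR (S n) * z)).
Proof.
  intros Hq. unfold theta_cos. rewrite Series_incr_1.
  - assert (E : forall n, Rpower q ((INR (S n)) ^ 2) = q ^ (S n * S n)).
    { intros n. rewrite <- (Rpower_pow _ q) by lra. f_equal. rewrite mult_INR. ring. }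
    rewrite (Series_ext _ (fun n => q ^ (S n * S n) * cos (2 * INR (S n) * z))).
    2:{ intros n. now rewrite Rplus_0_r, E. }
    rewrite (Series_ext (fun n => Rpower q ((INR n + 1 - 0) ^ 2) * _)
      (fun n => q ^ (S n * S n) * cos (2 * INR (S n) * z))).
    2:{ intros n. now rewrite Rminus_0_r, <- S_INR, E. }
    simpl INR at 1 2. replace ((0 + 0) ^ 2) with 0 by ring.
    rewrite Rpower_O by lra. replace (2 * (0 + 0) * z) with 0 by ring. rewrite cos_0. ring.
  - apply ex_series_Rabs, (ex_series_gauss q (fun n => INR n + 0) (fun n => cos (2 * (INR n + 0) * z)));
        trivial; intros; [lra|apply Rabs_le, COS_bound].
Qed.

Lemma th2_eq q z :
  th2 q z = 2 * Series (fun n => Rpower q ((INR n + / 2) ^ 2) * cos (INR (2 * n + 1) * z)).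
Proof.
  unfold theta_cos.
  assert (E : forall n, 2 * (INR n + / 2) = INR (2 * n + 1)).
  { intros n. rewrite plus_INR, mult_INR. simpl. field. }
  rewrite (Series_ext (fun n => Rpower q ((INR n + / 2) ^ 2) * _)
    (fun n => Rpower q ((INR n + / 2) ^ 2) * cos (INR (2 * n + 1) * z))).
  2:{ intros n. now rewrite E. }
  rewrite (Series_ext (fun n => Rpower q ((INR n + 1 - / 2) ^ 2) * _)
    (fun n => Rpower q ((INR n + / 2) ^ 2) * cos (INR (2 * n + 1) * z))); [ring|].
  intros n. replace (INR n + 1 - / 2) with (INR n + / 2) by field. now rewrite E.
Qed.

Lemma theta_even e q z : theta_cos e q (- z) = theta_cos e q z.
Proof.
  unfold theta_cos. f_equal; apply Series_ext; intros n; f_equal; rewrite <- cos_neg; f_equal; ring.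
Qed.

Lemma th3_period q z : 0 < q < 1 -> th3 q (z + PI) = th3 q z.
Proof.
  intros Hq. rewrite !th3_eq by trivial. do 2 f_equal. apply Series_ext; intros n. f_equal.
  replace (2 * INR (S n) * (z + PI)) with (2 * INR (S n) * z + 2 * INR (S n) * PI) by ring.
  apply cos_period.
Qed.

Lemma th2_antiperiod q z : th2 q (z + PI) = - th2 q z.
Proof.
  rewrite !th2_eq. rewrite Ropp_mult_distr_r, <- Series_opp. f_equal.
  apply Series_ext; intros n. rewrite Ropp_mult_distr_r. f_equal.
  replace (INR (2 * n + 1) * (z + PI)) with (INR (2 * n + 1) * z + PI + 2 * INR n * PI).
  - rewrite cos_period. apply neg_cos.
  - rewrite plus_INR, mult_INR. simpl. ring.
Qed.

Lemma th2_half_pi q : th2 q (PI / 2) = 0.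
Proof.
  pose proof (th2_antiperiod q (- (PI / 2))) as H.
  rewrite theta_even in H. replace (- (PI / 2) + PI) with (PI / 2) in H by field. lra.
Qed.

Lemma pow_anti q m n : 0 < q < 1 -> (m <= n)%nat -> q ^ n <= q ^ m.
Proof.
  intros Hq H. replace n with (m + (n - m))%nat by lia. rewrite pow_add.
  assert (0 < q ^ m) by (apply pow_lt; lra).
  assert (q ^ (n - m) <= 1) by (rewrite <- (pow1 (n - m)); apply pow_incr; lra). nra.
Qed.

Lemma Rabs_sin_le x : Rabs (sin x) <= Rabs x.
Proof.
  assert (A : forall y, 0 < y -> Rabs (sin y) <= y).
  { intros y Hy. destruct (Rle_dec y 1) as [H1|H1].
    - rewrite Rabs_pos_eq; [left; now apply sin_lt_x|].
      apply sin_ge_0; [lra|]. pose proof PI2_1. lra.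
    - pose proof (SIN_bound y). apply Rabs_le. lra. }
  destruct (Rtotal_order x 0) as [H|[->|H]].
  - rewrite (Rabs_left x), <- (Rabs_Ropp (sin x)), <- sin_neg by trivial. apply A. lra.
  - rewrite sin_0. lra.
  - rewrite (Rabs_pos_eq x) by lra. now apply A.
Qed.

Lemma Rabs_cos_sub x y : Rabs (cos x - cos y) <= Rabs (x - y).
Proof.
  rewrite form2, !Rabs_mult. pose proof (Rabs_sin_le ((x - y) / 2)) as H1.
  pose proof (Rabs_pos (sin ((x - y) / 2))).
  assert (H2 : Rabs (sin ((x + y) / 2)) <= 1) by apply Rabs_le, SIN_bound.
  pose proof (Rabs_pos (sin ((x + y) / 2))).
  replace (Rabs (-2)) with 2 by (rewrite Rabs_left; lra).
  unfold Rdiv in H1 at 2. rewrite Rabs_mult, (Rabs_pos_eq (/ 2)) in H1 by lra. nra.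
Qed.

Lemma ex_series_geom_S q : 0 < q < 1 -> ex_series (fun n => q ^ S n).
Proof.
  intros Hq. apply (ex_series_incr_1 (fun n => q ^ n)), ex_series_geom. rewrite Rabs_pos_eq; lra.
Qed.

Lemma Series_geom_S q : 0 < q < 1 -> Series (fun n => q ^ S n) = q / (1 - q).
Proof.
  intros Hq. simpl. rewrite Series_scal_l, Series_geom by (rewrite Rabs_pos_eq; lra).
  reflexivity.
Qed.

Lemma th3_near_1 q z : 0 < q < 1 -> q <= / 4 -> Rabs (th3 q z - 1) <= 3 * q.
Proof.
  intros Hq Hs. rewrite th3_eq by trivial.
  match goal with |- Rabs (1 + 2 * ?S - 1) <= _ => replace (1 + 2 * S - 1) with (2 * S) by ring end.
  rewrite Rabs_mult, (Rabs_pos_eq 2) by lra.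
  apply Rle_trans with (2 * (q / (1 - q))).
  - apply Rmult_le_compat_l; [lra|]. rewrite <- Series_geom_S by trivial.
    apply Series_Rabs_le; [|now apply ex_series_geom_S]. intros n.
    rewrite Rabs_mult, Rabs_pos_eq by (apply pow_le; lra).
    assert (Rabs (cos (2 * INR (S n) * z)) <= 1) by apply Rabs_le, COS_bound.
    assert (q ^ (S n * S n) <= q ^ S n) by (apply pow_anti; trivial; lia).
    assert (0 < q ^ (S n * S n)) by (apply pow_lt; lra).
    pose proof (Rabs_pos (cos (2 * INR (S n) * z))). nra.
  - apply Rmult_le_reg_r with (1 - q); [lra|]. field_simplify; [nra|lra].
Qed.

Lemma th3_0_ge_1 q : 0 < q < 1 -> 1 <= th3 q 0.
Proof.
  intros Hq. rewrite th3_eq by trivial.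
  enough (0 <= Series (fun n => q ^ (S n * S n) * cos (2 * INR (S n) * 0))) by lra.
  rewrite (Series_ext _ (fun n => q ^ (S n * S n))).
  2:{ intros n. rewrite Rmult_0_r, cos_0. ring. }
  apply Series_nonneg.
  - intros n. apply pow_le. lra.
  - apply (ex_series_le (V := R_CompleteNormedModule)) with (fun n => q ^ S n); [|now apply ex_series_geom_S].
    intros n. change (norm ?y) with (Rabs y). rewrite Rabs_pos_eq by (apply pow_le; lra).
    apply pow_anti; trivial; lia.
Qed.

Lemma th3_mul_th3_0 r z : 0 < r < 1 -> th3 r z * th3 r 0 = th3 (r ^ 2) z ^ 2 + th2 (r ^ 2) z ^ 2.
Proof. intros Hr. rewrite th3_mul_th3 by trivial. rewrite Rplus_0_r, Rminus_0_r. ring. Qed.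

Lemma th2_mul_th2_0 r z : 0 < r < 1 -> th2 r z * th2 r 0 = 2 * th2 (r ^ 2) z * th3 (r ^ 2) z.
Proof. intros Hr. rewrite th2_mul_th2 by trivial. rewrite Rplus_0_r, Rminus_0_r. ring. Qed.

(** For small q the term 1 dominates.  The property is carried to larger nomes by
    theta_3(z,r) theta_3(0,r) = theta_3(z,r^2)^2 + theta_2(z,r^2)^2 and theta_3(0,r) >= 1. *)
Lemma th3_pos q : 0 < q < 1 -> forall z, 0 < th3 q z.
Proof.
  apply (nome_induction (/ 4) (fun q => forall z, 0 < th3 q z)); [lra| |]; clear q.
  - intros q Hq Hs z. pose proof (th3_near_1 q z Hq Hs) as H. apply Rabs_le_between in H. lra.
  - intros r Hr H z. pose proof (th3_mul_th3_0 r z Hr) as E. pose proof (th3_0_ge_1 r Hr).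
    specialize (H z). nra.
Qed.

Lemma Rabs_cos_odd_mul n z : Rabs (cos (INR (2 * n + 1) * z)) <= INR (2 * n + 1) * Rabs (cos z).
Proof.
  induction n as [|n IH].
  - simpl. rewrite !Rmult_1_l. lra.
  - replace (INR (2 * S n + 1) * z) with (INR (2 * n + 1) * z + 2 * z).
    2:{ rewrite !plus_INR, !mult_INR, (S_INR n). simpl. ring. }
    replace (INR (2 * S n + 1)) with (INR (2 * n + 1) + 2).
    2:{ rewrite !plus_INR, !mult_INR, (S_INR n). simpl. ring. }
    rewrite cos_plus, sin_2a. unfold Rminus.
    eapply Rle_trans; [apply Rabs_triang|]. rewrite Rabs_Ropp, !Rabs_mult.
    assert (H1 : Rabs (cos (2 * z)) <= 1) by apply Rabs_le, COS_bound.
    assert (H2 : Rabs (sin (INR (2 * n + 1) * z)) <= 1) by apply Rabs_le, SIN_bound.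
    assert (H3 : Rabs (sin z) <= 1) by apply Rabs_le, SIN_bound.
    rewrite (Rabs_pos_eq 2) by lra.
    pose proof (Rabs_pos (cos (2 * z))). pose proof (Rabs_pos (sin (INR (2 * n + 1) * z))).
    pose proof (Rabs_pos (sin z)). pose proof (Rabs_pos (cos z)).
    pose proof (Rabs_pos (cos (INR (2 * n + 1) * z))).
    assert (Rabs (sin (INR (2 * n + 1) * z)) * (2 * Rabs (sin z) * Rabs (cos z)) <= 2 * Rabs (cos z)).
    { assert (Rabs (sin (INR (2 * n + 1) * z)) * Rabs (sin z) <= 1) by nra. nra. }
    nra.
Qed.

Lemma Rpower_half_int q n : 0 < q ->
  Rpower q ((INR n + / 2) ^ 2) = Rpower q (/ 4) * q ^ (n * n + n).
Proof.
  intros Hq. rewrite <- (Rpower_pow _ q), <- Rpower_plus by trivial. f_equal.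
  rewrite plus_INR, mult_INR. field.
Qed.

Lemma ex_series_th2 q z : 0 < q < 1 ->
  ex_series (fun n => Rpower q ((INR n + / 2) ^ 2) * cos (INR (2 * n + 1) * z)).
Proof.
  intros Hq. apply ex_series_Rabs.
  apply (ex_series_gauss q (fun n => INR n + / 2) (fun n => cos (INR (2 * n + 1) * z))); trivial;
    intros; [lra|apply Rabs_le, COS_bound].
Qed.

(** The leading term dominates uniformly in z, up to the zeros of the cosine, because
    |cos((2n+1)z)| <= (2n+1) |cos z|, where 2n+1 <= 3^n is absorbed by q^(n^2+n) <= q^(2n). *)
Lemma th2_near_cos q z : 0 < q < 1 -> q <= / 4 ->
  Rabs (th2 q z - 2 * Rpower q (/ 4) * cos z) <= 2 * Rpower q (/ 4) * Rabs (cos z) * q.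
Proof.
  intros Hq Hs. rewrite th2_eq, Series_incr_1 by now apply ex_series_th2.
  rewrite Rpower_half_int by lra.
  simpl (INR (2 * 0 + 1)). simpl (q ^ (0 * 0 + 0)). rewrite Rmult_1_l, Rmult_1_r.
  set (a := Rpower q (/ 4)). assert (Ha : 0 < a) by apply exp_pos.
  match goal with |- Rabs (2 * (_ + ?S) - _) <= _ =>
    replace (2 * (a * cos z + S) - 2 * a * cos z) with (2 * S) by ring end.
  rewrite Rabs_mult, (Rabs_pos_eq 2) by lra.
  rewrite !Rmult_assoc. apply Rmult_le_compat_l; [lra|].
  assert (Hq2 : 0 < 3 * q ^ 2 < 1) by nra.
  apply Rle_trans with (a * Rabs (cos z) * (3 * q ^ 2 / (1 - 3 * q ^ 2))).
  - rewrite <- Series_geom_S, <- Series_scal_l by trivial.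
    apply Series_Rabs_le; [|apply (ex_series_scal_l (a * Rabs (cos z)) (fun n => (3 * q ^ 2) ^ S n)); now apply ex_series_geom_S].
    intros n. rewrite Rabs_mult, Rabs_pos_eq by (left; apply exp_pos).
    rewrite Rpower_half_int by lra. fold a.
    pose proof (Rabs_cos_odd_mul (S n) z) as H1.
    pose proof (poly (S n) 2 ltac:(lra)) as H2.
    assert (H3 : INR (2 * S n + 1) <= 3 ^ S n).
    { rewrite plus_INR, mult_INR. simpl (INR 2). simpl (INR 1).
      replace (3 ^ S n) with ((1 + 2) ^ S n) by (f_equal; ring). lra. }
    assert (H4 : q ^ (S n * S n + S n) <= (q ^ 2) ^ S n).
    { rewrite <- pow_mult. apply pow_anti; trivial. nia. }
    rewrite Rpow_mult_distr.
    pose proof (Rabs_pos (cos z)). pose proof (Rabs_pos (cos (INR (2 * S n + 1) * z))).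
    assert (0 < q ^ (S n * S n + S n)) by (apply pow_lt; lra).
    assert (H6 : Rabs (cos (INR (2 * S n + 1) * z)) <= 3 ^ S n * Rabs (cos z)).
    { apply Rle_trans with (1 := H1). now apply Rmult_le_compat_r. }
    rewrite Rmult_assoc. rewrite (Rmult_assoc a). apply Rmult_le_compat_l; [lra|].
    replace (Rabs (cos z) * (3 ^ S n * (q ^ 2) ^ S n)) with ((q ^ 2) ^ S n * (3 ^ S n * Rabs (cos z))) by ring.
    apply Rmult_le_compat; trivial; lra.
  - rewrite Rmult_assoc. apply Rmult_le_compat_l; [lra|]. apply Rmult_le_compat_l; [apply Rabs_pos|].
    apply Rmult_le_reg_r with (1 - 3 * q ^ 2); [lra|].
    replace (3 * q ^ 2 / (1 - 3 * q ^ 2) * (1 - 3 * q ^ 2)) with (3 * q ^ 2) by (field; lra). nra.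
Qed.

Lemma th2_0_nonneg q : 0 < q < 1 -> 0 <= th2 q 0.
Proof.
  intros Hq. rewrite th2_eq. apply Rmult_le_pos; [lra|]. apply Series_nonneg.
  - intros n. rewrite Rmult_0_r, cos_0. rewrite Rmult_1_r. left; apply exp_pos.
  - now apply ex_series_th2.
Qed.

(** Evident from the leading term for small q; then
    theta_2(z,r) theta_2(0,r) = 2 theta_2(z,r^2) theta_3(z,r^2) carries it to larger nomes. *)
Lemma th2_pos q : 0 < q < 1 -> forall z, - (PI / 2) < z < PI / 2 -> 0 < th2 q z.
Proof.
  apply (nome_induction (/ 4) (fun q => forall z, - (PI / 2) < z < PI / 2 -> 0 < th2 q z));
    [lra| |]; clear q.
  - intros q Hq Hs z Hz. pose proof (th2_near_cos q z Hq Hs) as H. apply Rabs_le_between in H.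
    assert (Hc : 0 < cos z) by (apply cos_gt_0; lra). rewrite Rabs_pos_eq in H by lra.
    assert (0 < Rpower q (/ 4)) by apply exp_pos.
    assert (0 < 2 * Rpower q (/ 4) * cos z) by (repeat apply Rmult_lt_0_compat; lra). nra.
  - intros r Hr H z Hz. pose proof (th2_mul_th2_0 r z Hr) as E.
    pose proof (th2_mul_th2_0 r 0 Hr) as E0. pose proof (th2_0_nonneg r Hr).
    pose proof PI_RGT_0. pose proof (H 0 ltac:(lra)). pose proof (H z Hz).
    pose proof (th3_pos _ (sqr_in_01 r Hr) z). pose proof (th3_pos _ (sqr_in_01 r Hr) 0).
    assert (0 < th2 (r ^ 2) 0 * th3 (r ^ 2) 0) by now apply Rmult_lt_0_compat.
    assert (0 < th2 (r ^ 2) z * th3 (r ^ 2) z) by now apply Rmult_lt_0_compat.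
    assert (0 < th2 r 0) by nra. nra.
Qed.

(** * Continuity, quadratic identities and the value of theta_1'(0) *)

(** Bernoulli's inequality for 1 / sqrt q bounds (n+1) (sqrt q)^n by a constant. *)
Lemma ex_series_linear_geom q : 0 < q < 1 -> ex_series (fun n => INR (S n) * q ^ n).
Proof.
  intros Hq. set (s := sqrt q).
  assert (Hs : 0 < s) by (apply sqrt_lt_R0; lra).
  assert (Hss : s * s = q) by (apply sqrt_def; lra).
  assert (Hs1 : s < 1) by nra.
  set (x := / s - 1).
  assert (Hx : 0 < x) by (unfold x; rewrite <- Rinv_1; apply Rlt_0_minus, Rinv_lt_contravar; lra).
  apply (ex_series_le (V := R_CompleteNormedModule)) with (fun n => (1 + / x) * s ^ n).
  - intros n. change (norm ?y) with (Rabs y).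
    rewrite Rabs_pos_eq by (apply Rmult_le_pos; [apply pos_INR|apply pow_le; lra]).
    rewrite <- Hss, Rpow_mult_distr, <- Rmult_assoc.
    apply Rmult_le_compat_r; [apply pow_le; lra|].
    pose proof (poly n x Hx) as H. replace (1 + x) with (/ s) in H by (unfold x; ring).
    rewrite pow_inv in H.
    assert (P : 0 < s ^ n) by (apply pow_lt; lra).
    assert (H1 : (1 + INR n * x) * s ^ n <= 1).
    { replace 1 with (/ s ^ n * s ^ n) at 2 by (field; lra). apply Rmult_le_compat_r; lra. }
    rewrite S_INR. pose proof (pos_INR n). assert (0 < / x) by now apply Rinv_0_lt_compat.
    apply Rle_trans with ((1 + / x) * ((1 + INR n * x) * s ^ n)); [|nra].
    replace ((1 + / x) * ((1 + INR n * x) * s ^ n))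
      with ((INR n + 1 + (/ x + INR n * x)) * s ^ n) by (field; lra).
    apply Rmult_le_compat_r; [lra|]. nra.
  - apply (ex_series_scal_l (1 + / x) (fun n => s ^ n)), ex_series_geom.
    rewrite Rabs_pos_eq; lra.
Qed.

Lemma gauss_series_lipschitz q (x : nat -> R) z z' : 0 < q < 1 ->
  (forall n, INR n <= x n <= INR n + 1) ->
  Rabs (Series (fun n => Rpower q (x n ^ 2) * cos (2 * x n * z))
        - Series (fun n => Rpower q (x n ^ 2) * cos (2 * x n * z')))
  <= 2 * Rabs (z - z') * Series (fun n => INR (S n) * q ^ n).
Proof.
  intros Hq Hx.
  assert (E : forall z, ex_series (fun n => Rpower q (x n ^ 2) * cos (2 * x n * z))).
  { intros y. apply ex_series_Rabs.
    apply (ex_series_gauss q x (fun n => cos (2 * x n * y))); trivial;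
      intros; [apply Hx|apply Rabs_le, COS_bound]. }
  rewrite <- Series_minus, <- Series_scal_l by trivial.
  apply Series_Rabs_le.
  - intros n. rewrite <- Rmult_minus_distr_l, Rabs_mult, Rabs_pos_eq by (left; apply exp_pos).
    pose proof (Rabs_cos_sub (2 * x n * z) (2 * x n * z')) as H.
    rewrite <- Rmult_minus_distr_l, Rabs_mult in H.
    destruct (Hx n) as [H1 H2]. pose proof (pos_INR n).
    rewrite (Rabs_pos_eq (2 * x n)) in H by lra.
    pose proof (Rpower_gauss_le q (x n) n Hq H1).
    rewrite S_INR. pose proof (Rabs_pos (z - z')).
    replace (2 * Rabs (z - z') * ((INR n + 1) * q ^ n)) with (q ^ n * (2 * (INR n + 1) * Rabs (z - z'))) by ring.
    apply Rmult_le_compat; trivial; [left; apply exp_pos|apply Rabs_pos|].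
    apply Rle_trans with (1 := H). apply Rmult_le_compat_r; lra.
  - apply (ex_series_scal_l (2 * Rabs (z - z')) (fun n => INR (S n) * q ^ n)).
    now apply ex_series_linear_geom.
Qed.

Lemma theta_continuous (q e z : R) : 0 < q < 1 -> 0 <= e <= / 2 -> continuous (theta_cos e q) z.
Proof.
  intros Hq He. set (C := Series (fun n => INR (S n) * q ^ n)).
  assert (HC : 0 <= C).
  { apply Series_nonneg; [|now apply ex_series_linear_geom].
    intros n. apply Rmult_le_pos; [apply pos_INR|apply pow_le; lra]. }
  assert (L : forall y, Rabs (theta_cos e q y - theta_cos e q z) <= 4 * C * Rabs (y - z)).
  { intros y. unfold theta_cos.
    pose proof (gauss_series_lipschitz q (fun n => INR n + e) y z Hq ltac:(intros; cbv beta; lra)) as H1.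
    pose proof (gauss_series_lipschitz q (fun n => INR n + 1 - e) y z Hq ltac:(intros; cbv beta; lra)) as H2.
    cbv beta in H1, H2. fold C in H1, H2.
    match goal with |- Rabs (?a + ?b - (?c + ?d)) <= _ =>
      replace (a + b - (c + d)) with ((a - c) + (b - d)) by ring end.
    eapply Rle_trans; [apply Rabs_triang|]. lra. }
  apply continuity_pt_filterlim. intros eps Heps.
  exists (eps / (4 * C + 1)). split; [apply Rdiv_lt_0_compat; lra|].
  intros y [_ Hy]. simpl in *. unfold R_dist in *.
  apply Rle_lt_trans with (1 := L y).
  apply Rle_lt_trans with ((4 * C + 1) * Rabs (y - z)); [pose proof (Rabs_pos (y - z)); nra|].
  replace eps with ((4 * C + 1) * (eps / (4 * C + 1))) by (field; lra).
  apply Rmult_lt_compat_l; lra.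
Qed.

(** The shifts by pi/2 in this definition and the next one are the classical relations between
    the four theta functions. *)
Definition th1 (q z : R) := th2 q (z - PI / 2).
Definition th4 (q z : R) := th3 q (z + PI / 2).

Lemma th1_odd q z : th1 q (- z) = - th1 q z.
Proof.
  unfold th1. rewrite <- theta_even. replace (- (- z - PI / 2)) with (z - PI / 2 + PI) by field.
  apply th2_antiperiod.
Qed.

Lemma th1_0 q : th1 q 0 = 0.
Proof. pose proof (th1_odd q 0) as H. rewrite Ropp_0 in H. lra. Qed.

Lemma th4_pos q z : 0 < q < 1 -> 0 < th4 q z.
Proof. intros Hq. now apply th3_pos. Qed.

Lemma th4_even q z : 0 < q < 1 -> th4 q (- z) = th4 q z.
Proof.
  intros Hq. unfold th4. rewrite <- theta_even.
  rewrite <- (th3_period q (- (- z + PI / 2))) by trivial. f_equal. field.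
Qed.

(** This is [th2_mul_th2] shifted by pi/2.  Divided by theta_4(a) theta_4(b) it factors the
    difference theta_1(a)/theta_4(a) - theta_1(b)/theta_4(b), with a factor vanishing at a = b;
    so the derivative of theta_1 / theta_4 only involves theta_1'(0). *)
Lemma th1_th4_sub r a b : 0 < r < 1 ->
  th1 (r ^ 2) a * th4 (r ^ 2) b - th4 (r ^ 2) a * th1 (r ^ 2) b
  = th1 r ((a - b) / 2) * th2 r ((a + b) / 2).
Proof.
  intros Hr. unfold th1 at 3. rewrite th2_mul_th2 by trivial.
  replace ((a - b) / 2 - PI / 2 + (a + b) / 2) with (a - PI / 2) by field.
  replace ((a - b) / 2 - PI / 2 - (a + b) / 2) with (- (b + PI / 2)) by field.
  rewrite !theta_even. fold (th1 (r ^ 2) a) (th4 (r ^ 2) b).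
  replace (th2 (r ^ 2) (b + PI / 2)) with (- th1 (r ^ 2) b).
  - replace (th3 (r ^ 2) (a - PI / 2)) with (th4 (r ^ 2) a); [ring|].
    unfold th4. rewrite <- (th3_period (r ^ 2) (a - PI / 2)) by now apply sqr_in_01.
    f_equal. field.
  - unfold th1. rewrite <- th2_antiperiod. f_equal. field.
Qed.

Lemma th1_mul_th2 r z : 0 < r < 1 -> th1 r z * th2 r z = th1 (r ^ 2) (2 * z) * th4 (r ^ 2) 0.
Proof.
  intros Hr. pose proof (th1_th4_sub r (2 * z) 0 Hr) as H. rewrite th1_0 in H.
  replace ((2 * z - 0) / 2) with z in H by field. replace ((2 * z + 0) / 2) with z in H by field.
  lra.
Qed.

Lemma th3_mul_th4_0 r : 0 < r < 1 -> th3 r 0 * th4 r 0 = th4 (r ^ 2) 0 ^ 2.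
Proof.
  intros Hr. unfold th4. rewrite th3_mul_th3 by trivial. rewrite !Rplus_0_l.
  replace (0 - PI / 2) with (- (PI / 2)) by ring.
  rewrite !theta_even, th2_half_pi. ring.
Qed.

(** The squares of the four functions at z are linear combinations of the theta functions of
    nome q^2 at 2z and at 0; both relations then become polynomial identities. *)
Lemma theta_squares q z : 0 < q < 1 ->
  th4 q 0 ^ 2 * th2 q z ^ 2 = th2 q 0 ^ 2 * th4 q z ^ 2 - th3 q 0 ^ 2 * th1 q z ^ 2
  /\ th4 q 0 ^ 2 * th3 q z ^ 2 = th3 q 0 ^ 2 * th4 q z ^ 2 - th2 q 0 ^ 2 * th1 q z ^ 2.
Proof.
  intros Hq. assert (Hp := sqr_in_01 q Hq).
  assert (E3 : forall z, th3 q z ^ 2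
    = th3 (q ^ 2) (2 * z) * th3 (q ^ 2) 0 + th2 (q ^ 2) (2 * z) * th2 (q ^ 2) 0).
  { intros y. simpl. rewrite Rmult_1_r, th3_mul_th3 by trivial.
    now replace (y + y) with (2 * y) by ring; replace (y - y) with 0 by ring. }
  assert (E2 : forall z, th2 q z ^ 2
    = th2 (q ^ 2) (2 * z) * th3 (q ^ 2) 0 + th3 (q ^ 2) (2 * z) * th2 (q ^ 2) 0).
  { intros y. simpl. rewrite Rmult_1_r, th2_mul_th2 by trivial.
    now replace (y + y) with (2 * y) by ring; replace (y - y) with 0 by ring. }
  assert (E4 : forall z, th4 q z ^ 2
    = th3 (q ^ 2) (2 * z) * th3 (q ^ 2) 0 - th2 (q ^ 2) (2 * z) * th2 (q ^ 2) 0).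
  { intros y. unfold th4. rewrite E3.
    replace (2 * (y + PI / 2)) with (2 * y + PI) by field.
    rewrite th2_antiperiod, th3_period by trivial. ring. }
  assert (E1 : th1 q z ^ 2
    = - (th2 (q ^ 2) (2 * z) * th3 (q ^ 2) 0) + th3 (q ^ 2) (2 * z) * th2 (q ^ 2) 0).
  { unfold th1. rewrite E2.
    rewrite <- (th3_period _ (2 * (z - PI / 2))) by trivial.
    replace (th2 (q ^ 2) (2 * (z - PI / 2))) with (- th2 (q ^ 2) (2 * z)).
    - replace (2 * (z - PI / 2) + PI) with (2 * z) by field. ring.
    - rewrite <- (Ropp_involutive (th2 _ (2 * (z - PI / 2)))).
      rewrite <- (th2_antiperiod _ (2 * (z - PI / 2))). do 2 f_equal. field. }
  rewrite !E1, !E2, !E3, !E4. rewrite !Rmult_0_r. split; ring.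
Qed.

Definition theta_null_prod q := th2 q 0 * th3 q 0 * th4 q 0.

Lemma th2_0_pos q : 0 < q < 1 -> 0 < th2 q 0.
Proof. intros Hq. apply th2_pos; trivial. pose proof PI_RGT_0. lra. Qed.

Lemma theta_null_prod_pos q : 0 < q < 1 -> 0 < theta_null_prod q.
Proof.
  intros Hq. unfold theta_null_prod. pose proof (th2_0_pos q Hq). pose proof (th3_pos q Hq 0).
  pose proof (th4_pos q 0 Hq). repeat apply Rmult_lt_0_compat; trivial.
Qed.

(** The upper and lower limits, as h tends to 0, of theta_1(h) / (h theta_2 theta_3 theta_4) are
    within [eps] of 1.  The quantification over [eps'] makes the property pass from the nome r^2
    to r with the same [eps]. *)
Definition th1_slope_within (eps q : R) : Prop :=
  forall eps', eps < eps' ->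
    Rbar_locally' 0 (fun h => Rabs (th1 q h / (h * theta_null_prod q) - 1) < eps').

(** For small q, theta_1(h) is close to 2 q^(1/4) sin h and theta_2 theta_3 theta_4 to 2 q^(1/4). *)
Lemma th1_slope_small q : 0 < q < 1 -> q <= / 100 -> th1_slope_within (10 * q) q.
Proof.
  intros Hq Hs eps' He.
  pose proof is_lim_sinc_0 as Hsinc. apply is_lim_spec in Hsinc.
  specialize (Hsinc (mkposreal q (proj1 Hq))). simpl in Hsinc.
  destruct Hsinc as [d Hd].
  exists d. intros h Hh Hh0. specialize (Hd h Hh Hh0).
  set (a := 2 * Rpower q (/ 4)).
  assert (Ha : 0 < a) by (apply Rmult_lt_0_compat; [lra|apply exp_pos]).
  pose proof (th2_near_cos q (h - PI / 2) Hq ltac:(lra)) as H1. fold a in H1.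
  assert (Ec : cos (h - PI / 2) = sin h).
  { rewrite <- cos_neg. replace (- (h - PI / 2)) with (PI / 2 - h) by ring. apply cos_shift. }
  rewrite Ec in H1. fold (th1 q h) in H1.
  pose proof (th2_near_cos q 0 Hq ltac:(lra)) as H2. fold a in H2.
  rewrite cos_0, Rabs_R1, !Rmult_1_r in H2.
  pose proof (th3_near_1 q 0 Hq ltac:(lra)) as H3.
  pose proof (th3_near_1 q (0 + PI / 2) Hq ltac:(lra)) as H4. fold (th4 q 0) in H4.
  set (x := sin h / h) in *. set (y := th1 q h / (a * h)).
  set (u := th2 q 0 / a). set (v := th3 q 0) in *. set (w := th4 q 0) in *.
  apply Rabs_lt_between in Hd. apply Rabs_le_between in H3. apply Rabs_le_between in H4.
  assert (Hu : 1 - q <= u <= 1 + q).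
  { apply Rabs_le_between in H2. unfold u. split.
    - apply Rmult_le_reg_r with a; trivial. unfold Rdiv. rewrite Rmult_assoc, Rinv_l; lra.
    - apply Rmult_le_reg_r with a; trivial. unfold Rdiv. rewrite Rmult_assoc, Rinv_l; lra. }
  assert (Hy : Rabs (y - x) <= x * q).
  { replace (y - x) with ((th1 q h - a * sin h) * / (a * h)) by (unfold x, y; field; lra).
    rewrite Rabs_mult.
    replace (x * q) with (a * Rabs (sin h) * q * Rabs (/ (a * h))).
    - apply Rmult_le_compat_r; [apply Rabs_pos|trivial].
    - rewrite Rabs_inv, Rabs_mult, (Rabs_pos_eq a) by lra.
      replace x with (Rabs (sin h / h)) by (apply Rabs_pos_eq; fold x; lra).
      unfold Rdiv. rewrite Rabs_mult, Rabs_inv. field. split; [|lra]. now apply Rabs_no_R0. }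
  apply Rabs_le_between in Hy.
  assert (Hx1 : x <= 1 + q) by lra.
  replace (th1 q h / (h * theta_null_prod q)) with (y / (u * v * w)).
  2:{ unfold theta_null_prod. fold v w. unfold y, u. field.
      pose proof (th2_0_pos q Hq). repeat split; lra. }
  assert (Huv : (1 - q) * (1 - 3 * q) <= u * v <= (1 + q) * (1 + 3 * q)).
  { split; apply Rmult_le_compat; lra. }
  assert (Huvw : (1 - q) * (1 - 3 * q) * (1 - 3 * q) <= u * v * w
     <= (1 + q) * (1 + 3 * q) * (1 + 3 * q)).
  { split; apply Rmult_le_compat; try lra; nra. }
  set (D := u * v * w) in *.
  assert (HD : 0 < D) by nra.
  apply Rle_lt_trans with (2 := He). apply Rabs_le. split.
  - apply Rmult_le_reg_r with D; trivial.
    replace ((y / D - 1) * D) with (y - D) by (field; lra).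
    assert ((1 - q) * (1 - q) <= y) by nra. nra.
  - apply Rmult_le_reg_r with D; trivial.
    replace ((y / D - 1) * D) with (y - D) by (field; lra).
    assert (y <= (1 + q) * (1 + q)) by nra. nra.
Qed.

(** The quotient theta_1(h,r) / (h theta_2 theta_3 theta_4(r)) equals its value at 2h and nome r^2,
    times theta_2(0,r) / theta_2(h,r), by the duplication of theta_1 and the relations between
    the values at 0 for the nomes r and r^2. *)
Lemma th1_slope_lift eps r : 0 <= eps -> 0 < r < 1 ->
  th1_slope_within eps (r ^ 2) -> th1_slope_within eps r.
Proof.
  intros H0 Hr H eps' He. assert (Hq := sqr_in_01 r Hr).
  set (m := (eps + eps') / 2). assert (Hm : eps < m < eps') by (unfold m; lra).
  destruct (H m (proj1 Hm)) as [d1 Hd1].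
  (* Chosen so that |x - 1| < m and |y - 1| < k give |x y - 1| < m k + m + k = eps'. *)
  set (k := (eps' - m) / (m + 1)).
  assert (Hk : 0 < k) by (apply Rdiv_lt_0_compat; lra).
  assert (Hkm : m * k + k = eps' - m) by (unfold k; field; lra).
  assert (C : continuous (fun h => th2 r 0 / th2 r h) 0).
  { apply (continuous_mult (fun _ => th2 r 0) (fun h => / th2 r h)); [apply continuous_const|].
    apply (continuous_comp (th2 r) Rinv); [apply theta_continuous; lra|].
    apply continuous_Rinv. pose proof (th2_0_pos r Hr). lra. }
  assert (C' : locally 0 (fun h => Rabs (th2 r 0 / th2 r h - 1) < k)).
  { apply (proj1 (filterlim_locally _ _)) with (eps := mkposreal k Hk) in C.
    revert C. apply filter_imp. intros h Hh. unfold ball in Hh; simpl in Hh.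
    unfold AbsRing_ball, abs, minus, plus, opp in Hh; simpl in Hh.
    replace (th2 r 0 / th2 r 0) with 1 in Hh; [exact Hh|].
    field. pose proof (th2_0_pos r Hr). lra. }
  destruct C' as [d2 Hd2].
  pose proof PI_RGT_0 as Hpi.
  assert (Hd : 0 < Rmin (d1 / 2) (Rmin d2 (PI / 2))).
  { pose proof (cond_pos d1). pose proof (cond_pos d2). repeat apply Rmin_pos; lra. }
  exists (mkposreal _ Hd). intros h Hh Hh0.
  unfold ball in Hh; simpl in Hh.
  unfold AbsRing_ball, abs, minus, plus, opp in Hh; simpl in Hh.
  rewrite Ropp_0, Rplus_0_r in Hh.
  apply Rmin_Rgt_l in Hh. destruct Hh as [Hh1 Hh]. apply Rmin_Rgt_l in Hh. destruct Hh as [Hh2 Hh3].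
  assert (A1 : Rabs (th1 (r ^ 2) (2 * h) / (2 * h * theta_null_prod (r ^ 2)) - 1) < m).
  { apply Hd1; [|lra]. unfold ball; simpl.
    unfold AbsRing_ball, abs, minus, plus, opp; simpl.
    rewrite Ropp_0, Rplus_0_r, Rabs_mult, (Rabs_pos_eq 2); lra. }
  assert (A2 : Rabs (th2 r 0 / th2 r h - 1) < k).
  { apply Hd2. unfold ball; simpl. unfold AbsRing_ball, abs, minus, plus, opp; simpl.
    rewrite Ropp_0, Rplus_0_r; trivial. }
  assert (Ph : 0 < th2 r h).
  { apply th2_pos; trivial. apply Rabs_def2 in Hh3. lra. }
  assert (P0 := th2_0_pos r Hr).
  assert (Q : th1 r h / (h * theta_null_prod r)
    = th1 (r ^ 2) (2 * h) / (2 * h * theta_null_prod (r ^ 2)) * (th2 r 0 / th2 r h)).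
  { pose proof (th1_mul_th2 r h Hr) as E1. pose proof (th3_mul_th4_0 r Hr) as E2.
    pose proof (th2_mul_th2_0 r 0 Hr) as E3.
    pose proof (th2_0_pos _ Hq). pose proof (th3_pos _ Hq 0). pose proof (th4_pos _ 0 Hq).
    replace (th1 r h) with (th1 (r ^ 2) (2 * h) * th4 (r ^ 2) 0 / th2 r h).
    2:{ rewrite <- E1. field. lra. }
    replace (theta_null_prod r) with (th2 r 0 * th4 (r ^ 2) 0 ^ 2).
    2:{ unfold theta_null_prod. rewrite Rmult_assoc, E2. ring. }
    replace (theta_null_prod (r ^ 2)) with (th2 r 0 * th2 r 0 * th4 (r ^ 2) 0 / 2).
    2:{ rewrite E3. unfold theta_null_prod. field. }
    field. repeat split; lra. }
  rewrite Q. revert A1 A2. generalize (th1 (r ^ 2) (2 * h) / (2 * h * theta_null_prod (r ^ 2))), (th2 r 0 / th2 r h).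
  intros x y A1 A2.
  replace (x * y - 1) with ((x - 1) * (y - 1) + (x - 1) + (y - 1)) by ring.
  eapply Rle_lt_trans; [apply Rabs_triang|]. eapply Rle_lt_trans;
    [apply Rplus_le_compat_r, Rabs_triang|]. rewrite Rabs_mult.
  pose proof (Rabs_pos (x - 1)). pose proof (Rabs_pos (y - 1)). nra.
Qed.

(** Jacobi's identity theta_1'(0) = theta_2(0) theta_3(0) theta_4(0), existence of the derivative
    included: the limiting deviation of theta_1(h) / (h theta_2 theta_3 theta_4) from 1 at nome r
    is at most the one at nome r^2, and tends to 0 with the nome; hence it is 0. *)
Lemma is_derive_th1_0 q : 0 < q < 1 -> is_derive (th1 q) 0 (theta_null_prod q).
Proof.
  intros Hq. apply is_derive_Reals. intros eps Heps.
  pose proof (theta_null_prod_pos q Hq) as HJ.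
  set (e := eps / (2 * theta_null_prod q)). assert (He : 0 < e) by (apply Rdiv_lt_0_compat; lra).
  assert (H : th1_slope_within e q).
  { clearbody e. clear HJ. revert q Hq.
    apply (nome_induction (Rmin (/ 100) (e / 10))).
    - apply Rmin_pos; lra.
    - intros q Hq Hs eps' He'.
      pose proof (Rmin_l (/ 100) (e / 10)). pose proof (Rmin_r (/ 100) (e / 10)).
      apply (th1_slope_small q Hq); lra.
    - intros r Hr. apply th1_slope_lift; lra. }
  destruct (H (2 * e) ltac:(lra)) as [d Hd].
  exists d. intros h Hh0 Hh. rewrite Rplus_0_l, th1_0, Rminus_0_r.
  replace (th1 q h / h - theta_null_prod q) with (theta_null_prod q * (th1 q h / (h * theta_null_prod q) - 1)) by (field; lra).
  rewrite Rabs_mult, Rabs_pos_eq by lra.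
  replace eps with (theta_null_prod q * (2 * e)) by (unfold e; field; lra).
  apply Rmult_lt_compat_l; trivial. apply Hd; trivial.
  unfold ball; simpl. unfold AbsRing_ball, abs, minus, plus, opp; simpl.
  now rewrite Ropp_0, Rplus_0_r.
Qed.

(** * The real Jacobi functions *)

Lemma is_derive_iff_is_lim (f : R -> R) (x l : R) :
  is_derive f x l <-> is_lim (fun h => (f (x + h) - f x) / h) 0 l.
Proof.
  rewrite is_derive_Reals, <- is_lim_spec.
  split; intros H eps.
  - destruct (H eps (cond_pos eps)) as [d Hd]. exists d. intros h Hh Hh0. apply Hd; trivial.
    unfold ball in Hh; simpl in Hh. unfold AbsRing_ball, abs, minus, plus, opp in Hh; simpl in Hh.
    now rewrite Ropp_0, Rplus_0_r in Hh.
  - intros Heps. destruct (H (mkposreal eps Heps)) as [d Hd]. exists d. intros h Hh0 Hh.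
    apply Hd; trivial. unfold ball; simpl. unfold AbsRing_ball, abs, minus, plus, opp; simpl.
    now rewrite Ropp_0, Rplus_0_r.
Qed.

Lemma is_derive_mult_vanishing (f g : R -> R) (x l : R) : f x = 0 -> is_derive f x l ->
  continuous g x -> is_derive (fun y => f y * g y) x (l * g x).
Proof.
  intros Hf Hd Hg. apply is_derive_iff_is_lim. apply is_derive_iff_is_lim in Hd.
  apply is_lim_ext with (fun h => (f (x + h) - f x) / h * g (x + h)).
  { intros h. rewrite Hf. unfold Rdiv. ring. }
  apply (is_lim_mult _ _ 0 l (g x)); trivial; [|easy].
  apply (is_lim_comp_continuous (fun h => x + h) g 0 x); trivial.
  replace (Finite x) with (Rbar_plus x 0) by (simpl; f_equal; ring).
  apply (is_lim_plus (fun _ => x) (fun h => h) 0 x 0); [apply is_lim_const|apply is_lim_id|easy].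
Qed.

Lemma th4_continuous (q z : R) : 0 < q < 1 -> continuous (th4 q) z.
Proof.
  intros Hq. apply (continuous_comp (fun z => z + PI / 2) (th3 q)).
  - apply (continuous_plus (V := R_NormedModule) (fun z => z) (fun _ => PI / 2));
      [apply continuous_id|apply continuous_const].
  - apply theta_continuous; lra.
Qed.

(** The difference quotient is explicit by [th1_th4_sub] at nome sqrt q, and Jacobi's identity
    evaluates its limit. *)
Lemma is_derive_th1_div_th4 (q b : R) : 0 < q < 1 ->
  is_derive (fun z => th1 q z / th4 q z) b (th4 q 0 ^ 2 * th2 q b * th3 q b / th4 q b ^ 2).
Proof.
  intros Hq0.
  (* The product formulas lead from the nome [r] to [r ^ 2], here [q]. *)
  set (r := sqrt q).
  assert (Hr : 0 < r < 1).
  { split; [apply sqrt_lt_R0; lra|]. unfold r. rewrite <- sqrt_1. apply sqrt_lt_1; lra. }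
  assert (Hrq : r ^ 2 = q) by (apply pow2_sqrt; lra).
  assert (P4 : forall z, 0 < th4 q z) by (intros; now apply th4_pos).
  apply is_derive_ext with
    (fun z => th1 q b / th4 q b + th1 r ((z - b) / 2) * (th2 r ((z + b) / 2) / (th4 q z * th4 q b))).
  { intros z. pose proof (th1_th4_sub r z b Hr) as H. rewrite Hrq in H.
    pose proof (P4 z). pose proof (P4 b).
    match goal with |- ?u = ?v => change (@eq R u v) end.
    transitivity (th1 q b / th4 q b
      + th1 r ((z - b) / 2) * th2 r ((z + b) / 2) / (th4 q z * th4 q b)); [field; lra|].
    rewrite <- H. field. lra. }
  replace (th4 q 0 ^ 2 * th2 q b * th3 q b / th4 q b ^ 2)
    with (0 + theta_null_prod r / 2 * (th2 r ((b + b) / 2) / (th4 q b * th4 q b))).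
  2:{ replace ((b + b) / 2) with b by field. unfold theta_null_prod.
      pose proof (th3_mul_th4_0 r Hr) as E1. pose proof (th2_mul_th2_0 r b Hr) as E2.
      rewrite Hrq in E1, E2. rewrite Rmult_assoc, E1. pose proof (P4 b).
      replace (th4 q 0 ^ 2 * th2 q b * th3 q b) with (th4 q 0 ^ 2 * (2 * th2 q b * th3 q b) / 2) by field.
      rewrite <- E2. field. lra. }
  apply (is_derive_plus (fun _ => th1 q b / th4 q b)
    (fun z => th1 r ((z - b) / 2) * (th2 r ((z + b) / 2) / (th4 q z * th4 q b)))).
  { apply (is_derive_const (V := R_NormedModule)). }
  apply (is_derive_mult_vanishing (fun z => th1 r ((z - b) / 2))
    (fun z => th2 r ((z + b) / 2) / (th4 q z * th4 q b))).
  - replace ((b - b) / 2) with 0 by field. apply th1_0.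
  - replace (theta_null_prod r / 2) with (scal (/ 2) (theta_null_prod r)) by (unfold scal; simpl; unfold mult; simpl; field).
    apply (is_derive_comp (th1 r) (fun z => (z - b) / 2)).
    + replace ((b - b) / 2) with 0 by field. now apply is_derive_th1_0.
    + auto_derive; trivial. field.
  - apply (continuous_mult (fun z => th2 r ((z + b) / 2)) (fun z => / (th4 q z * th4 q b))).
    + apply (continuous_comp (fun z => (z + b) / 2) (th2 r)); [|apply theta_continuous; lra].
      apply (ex_derive_continuous (fun z : R => (z + b) / 2)). auto_derive; trivial.
    + apply (continuous_comp (fun z => th4 q z * th4 q b) Rinv).
      * apply (continuous_mult (th4 q) (fun _ => th4 q b)); [now apply th4_continuous|apply continuous_const].
      * apply continuous_Rinv. pose proof (P4 b). nra.
Qed.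

(** The real functions sn, cn and dn as theta quotients.  As K = (pi/2) theta_3(0)^2, the theta
    argument pi u / (2K) is u / theta_3(0)^2. *)
Definition rsn (q u : R) : R :=
  th3 q 0 / th2 q 0 * (th1 q (u / th3 q 0 ^ 2) / th4 q (u / th3 q 0 ^ 2)).
Definition rcn (q u : R) : R :=
  th4 q 0 / th2 q 0 * (th2 q (u / th3 q 0 ^ 2) / th4 q (u / th3 q 0 ^ 2)).
Definition rdn (q u : R) : R :=
  th4 q 0 / th3 q 0 * (th3 q (u / th3 q 0 ^ 2) / th4 q (u / th3 q 0 ^ 2)).

Lemma rcn_sqr q u : 0 < q < 1 -> rcn q u ^ 2 = 1 - rsn q u ^ 2.
Proof.
  intros Hq. unfold rsn, rcn. set (z := u / th3 q 0 ^ 2).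
  destruct (theta_squares q z Hq) as [H _].
  pose proof (th2_0_pos q Hq). pose proof (th4_pos q z Hq).
  replace ((th4 q 0 / th2 q 0 * (th2 q z / th4 q z)) ^ 2)
    with (th4 q 0 ^ 2 * th2 q z ^ 2 / (th2 q 0 ^ 2 * th4 q z ^ 2)) by (field; lra).
  rewrite H. field. lra.
Qed.

Lemma rdn_sqr q u : 0 < q < 1 ->
  rdn q u ^ 2 = 1 - (th2 q 0 ^ 2 / th3 q 0 ^ 2) ^ 2 * rsn q u ^ 2.
Proof.
  intros Hq. unfold rsn, rdn. set (z := u / th3 q 0 ^ 2).
  destruct (theta_squares q z Hq) as [_ H].
  pose proof (th2_0_pos q Hq). pose proof (th4_pos q z Hq). pose proof (th3_pos q Hq 0).
  replace ((th4 q 0 / th3 q 0 * (th3 q z / th4 q z)) ^ 2)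
    with (th4 q 0 ^ 2 * th3 q z ^ 2 / (th3 q 0 ^ 2 * th4 q z ^ 2)) by (field; lra).
  rewrite H. field. lra.
Qed.

Lemma is_derive_rsn (q u : R) : 0 < q < 1 -> is_derive (rsn q) u (rcn q u * rdn q u).
Proof.
  intros Hq. unfold rsn, rcn, rdn.
  pose proof (th2_0_pos q Hq). pose proof (th3_pos q Hq 0). pose proof (th4_pos q (u / th3 q 0 ^ 2) Hq).
  match goal with |- is_derive _ _ ?l => replace l with
    (th3 q 0 / th2 q 0 * (/ th3 q 0 ^ 2 *
      (th4 q 0 ^ 2 * th2 q (u / th3 q 0 ^ 2) * th3 q (u / th3 q 0 ^ 2) / th4 q (u / th3 q 0 ^ 2) ^ 2)))
    by (field; lra) end.
  apply (is_derive_scal (fun u => th1 q (u / th3 q 0 ^ 2) / th4 q (u / th3 q 0 ^ 2))).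
  apply (is_derive_comp (fun z => th1 q z / th4 q z) (fun u => u / th3 q 0 ^ 2)).
  - now apply is_derive_th1_div_th4.
  - apply is_derive_ext with (fun t => / th3 q 0 ^ 2 * t); [intros t; change (/ th3 q 0 ^ 2 * t = t / th3 q 0 ^ 2 :> R); unfold Rdiv; ring|].
    auto_derive; trivial. simpl. field. lra.
Qed.

Lemma rsn_odd q u : 0 < q < 1 -> rsn q (- u) = - rsn q u.
Proof.
  intros Hq. unfold rsn. replace (- u / th3 q 0 ^ 2) with (- (u / th3 q 0 ^ 2)) by (unfold Rdiv; ring).
  rewrite th1_odd, th4_even by trivial. unfold Rdiv. ring.
Qed.

Lemma rsn_0 q : rsn q 0 = 0.
Proof. unfold rsn. replace (0 / th3 q 0 ^ 2) with 0 by (unfold Rdiv; ring). rewrite th1_0. unfold Rdiv. ring. Qed.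

Lemma rsn_K q : 0 < q < 1 -> rsn q (PI / 2 * th3 q 0 ^ 2) = 1.
Proof.
  intros Hq. pose proof (th2_0_pos q Hq). pose proof (th3_pos q Hq 0).
  unfold rsn. replace (PI / 2 * th3 q 0 ^ 2 / th3 q 0 ^ 2) with (PI / 2) by (field; lra).
  unfold th1, th4. replace (PI / 2 - PI / 2) with 0 by ring.
  replace (PI / 2 + PI / 2) with (0 + PI) by field. rewrite th3_period by trivial. field. lra.
Qed.

Lemma rcn_pos q u : 0 < q < 1 -> Rabs u < PI / 2 * th3 q 0 ^ 2 -> 0 < rcn q u.
Proof.
  intros Hq Hu. pose proof (th2_0_pos q Hq). pose proof (th3_pos q Hq 0) as P3.
  pose proof (th4_pos q 0 Hq).
  pose proof (th4_pos q (u / th3 q 0 ^ 2) Hq).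
  assert (0 < th3 q 0 ^ 2) by (apply pow_lt; lra).
  assert (0 < th2 q (u / th3 q 0 ^ 2)).
  { apply th2_pos; trivial. apply Rabs_def2 in Hu.
    split; (apply Rmult_lt_reg_r with (th3 q 0 ^ 2); [lra|]);
    replace (u / th3 q 0 ^ 2 * th3 q 0 ^ 2) with u by (field; lra); lra. }
  unfold rcn. apply Rmult_lt_0_compat; now apply Rdiv_lt_0_compat.
Qed.

Lemma rdn_pos q u : 0 < q < 1 -> 0 < rdn q u.
Proof.
  intros Hq. unfold rdn. pose proof (th3_pos q Hq).
  pose proof (fun z => th4_pos q z Hq).
  apply Rmult_lt_0_compat; now apply Rdiv_lt_0_compat.
Qed.

Lemma rsn_increasing q u v : 0 < q < 1 ->
  - (PI / 2 * th3 q 0 ^ 2) < u -> u < v -> v < PI / 2 * th3 q 0 ^ 2 -> rsn q u < rsn q v.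
Proof.
  intros Hq Hu Huv Hv.
  apply (incr_function (rsn q) (- (PI / 2 * th3 q 0 ^ 2)) (PI / 2 * th3 q 0 ^ 2)
    (fun u => rcn q u * rdn q u)); trivial; simpl; intros x Hx1 Hx2.
  - now apply is_derive_rsn.
  - apply Rmult_lt_0_compat; [|now apply rdn_pos]. apply rcn_pos; trivial. now apply Rabs_def1.
Qed.

Lemma rsn_bound q u : 0 < q < 1 -> Rabs u < PI / 2 * th3 q 0 ^ 2 -> -1 < rsn q u < 1.
Proof.
  intros Hq Hu. pose proof (rcn_pos q u Hq Hu). pose proof (rcn_sqr q u Hq). nra.
Qed.

(** Substituting t = sn u turns the integrand into 1, since sn' = cn dn and both factors are the
    positive square roots on (-K,K). *)
Lemma rsn_integral q y : 0 < q < 1 -> Rabs y < PI / 2 * th3 q 0 ^ 2 ->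
  RInt (fun t => / (sqrt (1 - t ^ 2) * sqrt (1 - (th2 q 0 ^ 2 / th3 q 0 ^ 2) ^ 2 * t ^ 2)))
    0 (rsn q y) = y.
Proof.
  intros Hq Hy. set (K := PI / 2 * th3 q 0 ^ 2) in *. set (k := th2 q 0 ^ 2 / th3 q 0 ^ 2).
  assert (Hin : forall x, Rmin 0 y <= x <= Rmax 0 y -> Rabs x < K).
  { intros x Hx. apply Rabs_def2 in Hy. pose proof (Rabs_pos y).
    revert Hx. unfold Rmin, Rmax. destruct (Rle_dec 0 y); intros Hx; apply Rabs_def1; lra. }
  assert (Ec : forall x, Rabs x < K -> sqrt (1 - rsn q x ^ 2) = rcn q x).
  { intros x Hx. rewrite <- rcn_sqr by trivial. apply sqrt_pow2. left. now apply rcn_pos. }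
  assert (Ed : forall x, sqrt (1 - k ^ 2 * rsn q x ^ 2) = rdn q x).
  { intros x. unfold k. rewrite <- rdn_sqr by trivial. apply sqrt_pow2. left. now apply rdn_pos. }
  rewrite <- (rsn_0 q).
  rewrite <- (RInt_comp (V := R_CompleteNormedModule)
    (fun t => / (sqrt (1 - t ^ 2) * sqrt (1 - k ^ 2 * t ^ 2)))
    (rsn q) (fun u => rcn q u * rdn q u) 0 y).
  - rewrite (RInt_ext _ (fun _ => 1)).
    + rewrite RInt_const. unfold scal; simpl; unfold mult; simpl. ring.
    + intros x Hx. assert (Hx' : Rabs x < K) by (apply Hin; lra).
      rewrite Ec, Ed by trivial. unfold scal; simpl; unfold mult; simpl. apply Rinv_r.
      pose proof (rcn_pos q x Hq Hx'). pose proof (rdn_pos q x Hq). nra.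
  - intros x Hx. specialize (Hin x Hx).
    pose proof (rcn_pos q x Hq Hin). pose proof (rdn_pos q x Hq).
    pose proof (rcn_sqr q x Hq). pose proof (rdn_sqr q x Hq) as Hd. fold k in Hd.
    specialize (Ec x Hin). specialize (Ed x).
    apply (ex_derive_continuous (fun t => / (sqrt (1 - t ^ 2) * sqrt (1 - k ^ 2 * t ^ 2)))).
    auto_derive. simpl in Ec, Ed, Hd, H1 |- *.
    repeat split; try nra.
    unfold Rminus in Ec, Ed. try rewrite Ec. try rewrite Ed. nra.
  - intros x Hx. split; [now apply is_derive_rsn|].
    assert (Cz : continuous (fun u => u / th3 q 0 ^ 2) x).
    { apply (continuous_mult (fun u : R => u) (fun _ => / th3 q 0 ^ 2)); [apply continuous_id|apply continuous_const]. }
    assert (C4 : continuous (fun u => / th4 q (u / th3 q 0 ^ 2)) x).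
    { apply (continuous_comp (fun u => u / th3 q 0 ^ 2) (fun z => / th4 q z)); trivial.
      apply (continuous_comp (th4 q) Rinv); [now apply th4_continuous|].
      apply continuous_Rinv. apply Rgt_not_eq. now apply th4_pos. }
    apply (continuous_mult (rcn q) (rdn q)).
    + apply (continuous_mult (fun _ => th4 q 0 / th2 q 0) (fun u => th2 q (u / th3 q 0 ^ 2) / th4 q (u / th3 q 0 ^ 2)));
        [apply continuous_const|].
      apply (continuous_mult (fun u => th2 q (u / th3 q 0 ^ 2)) (fun u => / th4 q (u / th3 q 0 ^ 2))); trivial.
      apply (continuous_comp (fun u => u / th3 q 0 ^ 2) (th2 q)); trivial. apply theta_continuous; lra.
    + apply (continuous_mult (fun _ => th4 q 0 / th3 q 0) (fun u => th3 q (u / th3 q 0 ^ 2) / th4 q (u / th3 q 0 ^ 2)));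
        [apply continuous_const|].
      apply (continuous_mult (fun u => th3 q (u / th3 q 0 ^ 2)) (fun u => / th4 q (u / th3 q 0 ^ 2))); trivial.
      apply (continuous_comp (fun u => u / th3 q 0 ^ 2) (th3 q)); trivial. apply theta_continuous; lra.
Qed.

(** * Restriction of the complex functions to the real axis *)

Lemma theta3_0_eq q : 0 < q < 1 -> theta3_0 q = th3 q 0.
Proof.
  intros Hq. rewrite th3_eq by trivial. unfold theta3_0. do 2 f_equal.
  apply Series_ext; intros n. rewrite Rmult_0_r, cos_0. ring.
Qed.

Lemma theta2_0_eq q : theta2_0 q = th2 q 0.
Proof.
  rewrite th2_eq. unfold theta2_0. f_equal.
  apply Series_ext; intros n. rewrite Rmult_0_r, cos_0. ring.
Qed.

Lemma Csin_real x : Csin (RtoC x) = RtoC (sin x).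
Proof. unfold Csin, RtoC; simpl. rewrite cosh_0, sinh_0. f_equal; ring. Qed.

Lemma Ccos_real x : Ccos (RtoC x) = RtoC (cos x).
Proof. unfold Ccos, RtoC; simpl. rewrite cosh_0, sinh_0. f_equal; ring. Qed.

Lemma CSeries_real (a : nat -> C) (b : nat -> R) :
  (forall n, a n = RtoC (b n)) -> CSeries a = RtoC (Series b).
Proof.
  intros H. unfold CSeries, RtoC. f_equal.
  - apply Series_ext. intros n. now rewrite H.
  - rewrite (Series_ext _ (fun n => 0 * b n)); [rewrite Series_scal_l; ring|].
    intros n. rewrite H. simpl. ring.
Qed.

Lemma cos_add_nat_PI n x : cos (x + INR n * PI) = (-1) ^ n * cos x.
Proof.
  induction n as [|n IH].
  - simpl. replace (x + 0 * PI) with x by ring. ring.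
  - rewrite S_INR. replace (x + (INR n + 1) * PI) with (x + INR n * PI + PI) by ring.
    rewrite neg_cos, IH. simpl. ring.
Qed.

Lemma theta4_real q z : 0 < q < 1 -> theta4 q (RtoC z) = RtoC (th4 q z).
Proof.
  intros Hq. unfold theta4, th4. rewrite th3_eq by trivial.
  rewrite (CSeries_real _ (fun n => q ^ (S n * S n) * cos (2 * INR (S n) * (z + PI / 2)))).
  - now rewrite RtoC_plus, RtoC_mult.
  - intros n. rewrite <- RtoC_mult, Ccos_real, <- RtoC_mult. f_equal.
    replace (2 * INR (S n) * (z + PI / 2)) with (INR (2 * S n) * z + INR (S n) * PI).
    + rewrite cos_add_nat_PI. ring.
    + rewrite mult_INR. simpl (INR 2). field.
Qed.

Lemma theta1_real q z : theta1 q (RtoC z) = RtoC (th1 q z).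
Proof.
  unfold theta1, th1. rewrite th2_eq.
  rewrite (CSeries_real _ (fun n => Rpower q ((INR n + / 2) ^ 2) * cos (INR (2 * n + 1) * (z - PI / 2)))).
  - now rewrite RtoC_mult.
  - intros n. rewrite <- RtoC_mult, Csin_real, <- RtoC_mult. f_equal.
    pose proof (cos_add_nat_PI n (INR (2 * n + 1) * (z - PI / 2))) as H.
    replace (INR (2 * n + 1) * (z - PI / 2) + INR n * PI)
      with (- (PI / 2 - INR (2 * n + 1) * z)) in H
      by (rewrite plus_INR, mult_INR; simpl (INR 2); simpl (INR 1); field).
    rewrite cos_neg, cos_shift in H. rewrite H.
    assert (S1 : (-1) ^ n * (-1) ^ n = 1).
    { rewrite <- Rpow_mult_distr. replace (-1 * -1) with 1 by ring. apply pow1. }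
    match goal with |- _ = ?v => rewrite <- (Rmult_1_l v), <- S1 end. ring.
Qed.

Lemma quarter_period_real q : 0 < q < 1 -> quarter_period q = PI / 2 * th3 q 0 ^ 2.
Proof. intros Hq. unfold quarter_period. now rewrite theta3_0_eq. Qed.

Lemma quarter_period_pos q : 0 < q < 1 -> 0 < quarter_period q.
Proof.
  intros Hq. rewrite quarter_period_real by trivial. pose proof (th3_pos q Hq 0).
  pose proof PI_RGT_0. apply Rmult_lt_0_compat; [lra|apply pow_lt; lra].
Qed.

Lemma sn_real q u : 0 < q < 1 -> sn q (RtoC u) = RtoC (rsn q u).
Proof.
  intros Hq. unfold sn, rsn. rewrite quarter_period_real by trivial.
  pose proof (th3_pos q Hq 0). pose proof PI_RGT_0.
  rewrite <- RtoC_mult.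
  replace (PI / (2 * (PI / 2 * th3 q 0 ^ 2)) * u) with (u / th3 q 0 ^ 2) by (field; lra).
  rewrite theta1_real, theta4_real, theta3_0_eq, theta2_0_eq by trivial.
  rewrite <- RtoC_div, <- RtoC_mult; trivial.
  apply Rgt_not_eq. now apply th4_pos.
Qed.

Lemma nome_in_01 T B : 0 < T -> 0 < B -> 0 < nome T B < 1.
Proof.
  intros HT HB. unfold nome. split; [apply exp_pos|].
  rewrite <- exp_0. apply exp_increasing.
  assert (0 < PI * B / T) by (apply Rdiv_lt_0_compat; [apply Rmult_lt_0_compat; [apply PI_RGT_0|]|]; trivial).
  replace (- PI * B / T) with (- (PI * B / T)) by (field; lra). lra.
Qed.

(** The endpoints K and -K are excluded because sn takes the values 1 and -1 there. *)
Lemma arcsn_spec q x : 0 < q < 1 -> -1 < x < 1 ->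
  Rabs (arcsn q x) < quarter_period q /\ rsn q (arcsn q x) = x.
Proof.
  intros Hq Hx. pose proof (quarter_period_pos q Hq) as HK.
  pose proof (rsn_K q Hq) as H1. pose proof (rsn_odd q (PI / 2 * th3 q 0 ^ 2) Hq) as H2.
  rewrite <- quarter_period_real in H1, H2 by trivial. rewrite H1 in H2.
  assert (Hex : exists y, - quarter_period q <= y <= quarter_period q /\ sn q (RtoC y) = RtoC x).
  { destruct (IVT_gen (rsn q) (- quarter_period q) (quarter_period q) x) as [y [Hy E]].
    - intros y. apply continuity_pt_filterlim. apply (ex_derive_continuous (rsn q)).
      eexists. now apply is_derive_rsn.
    - rewrite H1, H2, Rmin_left, Rmax_right; lra.
    - exists y. rewrite Rmin_left, Rmax_right in Hy by lra. split; trivial.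
      now rewrite sn_real, E. }
  pose proof (epsilon_spec (inhabits 0) _ Hex) as [A E]. fold (arcsn q x) in A, E.
  rewrite sn_real in E by trivial. apply RtoC_inj in E. split; trivial.
  apply Rabs_def1.
  - destruct (Req_dec (arcsn q x) (quarter_period q)) as [D|D]; [rewrite D in E|]; lra.
  - destruct (Req_dec (arcsn q x) (- quarter_period q)) as [D|D]; [rewrite D in E|]; lra.
Qed.

Lemma Phi_real T B x : 0 < T -> 0 < B -> - T < x < T ->
  let q := nome T B in let s := rsn q (quarter_period q / T * x) in
  -1 < s < 1 /\ Phi T B (RtoC x) = RtoC (2 * s / (1 - s)).
Proof.
  intros HT HB Hx q s. assert (Hq : 0 < q < 1) by now apply nome_in_01.
  assert (Hs : -1 < s < 1).
  { apply rsn_bound; trivial. rewrite <- quarter_period_real by trivial.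
    pose proof (quarter_period_pos q Hq) as HK.
    unfold Rdiv. rewrite Rmult_assoc, Rabs_mult, Rabs_pos_eq by lra.
    rewrite <- (Rmult_1_r (quarter_period q)) at 2. apply Rmult_lt_compat_l; trivial.
    apply Rabs_def1; apply Rmult_lt_reg_l with T; trivial; field_simplify; lra. }
  split; trivial. unfold Phi. fold q. rewrite <- RtoC_mult, sn_real by trivial. fold s.
  rewrite <- RtoC_mult, <- RtoC_minus, <- RtoC_div; trivial. lra.
Qed.

Lemma Csqrt_pos x : 0 < x -> Csqrt (RtoC x) = RtoC (sqrt x).
Proof.
  intros Hx. unfold Csqrt. rewrite Cmod_R, Rabs_pos_eq by lra. unfold RtoC; simpl.
  replace ((x + x) / 2) with x by field. replace ((x - x) / 2) with 0 by field.
  rewrite sqrt_0, Rmult_0_r. reflexivity.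
Qed.

Lemma is_derive_Re_Im_real (f : C -> C) (l : C) :
  is_derive (K := C_AbsRing) (V := C_NormedModule) f (RtoC 0) l ->
  is_derive (fun x : R => Re (f (RtoC x))) 0 (Re l) /\ is_derive (fun x : R => Im (f (RtoC x))) 0 (Im l).
Proof.
  intros [_ H]. specialize (H (RtoC 0) (fun P HP => HP)).
  assert (D : forall eps : posreal, locally 0 (fun x : R =>
    Cmod (f (RtoC x) - f (RtoC 0) - RtoC x * l)%C <= eps * Rabs x)).
  { intros eps. destruct (H eps) as [d Hd]. exists d. intros x Hx.
    assert (Hx' : ball (M := AbsRing_UniformSpace C_AbsRing) (RtoC 0) d (RtoC x)).
    { unfold ball in *; simpl in *. unfold AbsRing_ball, abs, minus, plus, opp in *; simpl in *.
      rewrite <- RtoC_opp, <- RtoC_plus, Cmod_R. exact Hx. }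
    specialize (Hd _ Hx'). unfold norm, minus, plus, opp, scal in Hd; simpl in Hd.
    unfold mult in Hd; simpl in Hd.
    rewrite <- RtoC_opp, <- RtoC_plus, Ropp_0, Rplus_0_r, Cmod_R in Hd.
    exact Hd. }
  assert (R2 : forall g m, (forall x, Rabs (g x - g 0 - x * m)
     <= Cmod (f (RtoC x) - f (RtoC 0) - RtoC x * l)%C) -> is_derive g 0 m).
  { intros g m Hg. apply is_derive_Reals. intros eps Heps.
    destruct (D (mkposreal (eps / 2) ltac:(lra))) as [d Hd]. exists d. intros h Hh0 Hh.
    assert (Hb : ball 0 d h).
    { unfold ball; simpl; unfold AbsRing_ball, abs, minus, plus, opp; simpl.
      now rewrite Ropp_0, Rplus_0_r. }
    specialize (Hd h Hb). simpl in Hd. specialize (Hg h).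
    rewrite Rplus_0_l. replace ((g h - g 0) / h - m) with ((g h - g 0 - h * m) / h) by (field; trivial).
    unfold Rdiv. rewrite Rabs_mult, Rabs_inv.
    pose proof (Rabs_pos_lt h Hh0).
    apply Rle_lt_trans with (eps / 2); [|lra].
    apply Rmult_le_reg_r with (Rabs h); trivial.
    rewrite Rmult_assoc, Rinv_l; lra. }
  split; apply R2; intros x.
  - eapply Rle_trans; [|eapply Rle_trans; [apply Rmax_l|apply Rmax_Cmod]]. right. f_equal.
    destruct (f (RtoC x)), (f (RtoC 0)), l. simpl. ring.
  - eapply Rle_trans; [|eapply Rle_trans; [apply Rmax_r|apply Rmax_Cmod]]. right. f_equal.
    destruct (f (RtoC x)), (f (RtoC 0)), l. simpl. ring.
Qed.

(** * Real g-fractions *)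

Fixpoint rdenom (g : nat -> R) (w : R) (n i : nat) : R :=
  match n with
  | O => 1
  | S m => 1 + gfrac_coef g i * w / rdenom g w m (S i)
  end.

(** Each denominator is 1 + (1 - g_(i+1)) X, where X = g_(i+2) w / D lies between 0 and w
    thanks to the bounds for the next denominator D.  For w < 0 this is the inequality
    g_(i+2) <= 1 + (1 - g_(i+2)) w <= D, where w > -1 enters. *)
Lemma rdenom_tail_bounds g w : -1 < w -> (forall i, (1 <= i)%nat -> 0 <= g i <= 1) ->
  forall n i, let c := (1 - g (S i)) * w in
  0 < rdenom g w n (S (S i)) /\
  (0 <= w -> 1 <= rdenom g w n (S (S i)) <= 1 + c) /\
  (w <= 0 -> 1 + c <= rdenom g w n (S (S i)) <= 1).
Proof.
  intros Hw Hg. induction n as [|n IH]; intros i c; pose proof (Hg (S i) ltac:(lia)) as H1.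
  - simpl. unfold c. repeat split; intros; nra.
  - simpl rdenom.
    destruct (IH (S i)) as [P [Hp Hn]].
    pose proof (Hg (S (S i)) ltac:(lia)) as H2.
    set (E := rdenom g w n (S (S (S i)))) in *.
    set (a := g (S i)) in *. set (b := g (S (S i))) in *.
    assert (bound : (0 <= w -> 0 <= b * w / E <= w) /\ (w <= 0 -> w <= b * w / E <= 0)).
    { split; intros Hs.
      - specialize (Hp Hs). split.
        + apply Rmult_le_reg_r with E; trivial. unfold Rdiv. rewrite Rmult_assoc, Rinv_l; nra.
        + apply Rmult_le_reg_r with E; trivial. unfold Rdiv. rewrite Rmult_assoc, Rinv_l; nra.
      - specialize (Hn Hs).
        assert (b <= E) by nra.
        split.
        + apply Rmult_le_reg_r with E; trivial. unfold Rdiv. rewrite Rmult_assoc, Rinv_l; nra.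
        + apply Rmult_le_reg_r with E; trivial. unfold Rdiv. rewrite Rmult_assoc, Rinv_l; nra. }
    replace ((1 - a) * b * w / E) with ((1 - a) * (b * w / E)) by (field; lra).
    set (X := b * w / E) in *. unfold c.
    destruct bound as [B1 B2].
    split; [|split; intros Hs].
    + destruct (Rle_dec 0 w) as [Hs|Hs]; [specialize (B1 Hs)|specialize (B2 ltac:(lra))]; nra.
    + specialize (B1 Hs). split; nra.
    + specialize (B2 Hs). split; nra.
Qed.

(** The denominator is 1 + g_1 w / D, with D between 1 and 1 + (1 - g_1) w; the two extreme
    values of D are ordered in the same way for both signs of w. *)
Lemma rdenom_head_bounds g w : -1 < w -> (forall i, (1 <= i)%nat -> 0 <= g i <= 1) ->
  forall n, (1 + w) / (1 + (1 - g 1%nat) * w) <= rdenom g w (S n) 1 <= 1 + g 1%nat * w.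
Proof.
  intros Hw Hg n. pose proof (Hg 1%nat ltac:(lia)) as H1.
  destruct (rdenom_tail_bounds g w Hw Hg n 0) as [P [Hp Hn]].
  simpl rdenom. set (D := rdenom g w n 2) in *. set (a := g 1%nat) in *.
  assert (Q : 0 < 1 + (1 - a) * w) by (destruct (Rle_dec 0 w); nra).
  split.
  - apply Rmult_le_reg_r with ((1 + (1 - a) * w) * D); [now apply Rmult_lt_0_compat|].
    field_simplify; [|lra|lra].
    destruct (Rle_dec 0 w) as [Hs|Hs]; [specialize (Hp Hs)|specialize (Hn ltac:(lra))].
    + assert (0 <= a * w) by nra. nra.
    + assert (0 <= a * - w) by nra. nra.
  - apply Rmult_le_reg_r with D; trivial. field_simplify; [|lra].
    destruct (Rle_dec 0 w) as [Hs|Hs]; [specialize (Hp Hs)|specialize (Hn ltac:(lra))].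
    + assert (0 <= a * w) by nra. nra.
    + assert (0 <= a * - w) by nra. nra.
Qed.

Lemma gfrac_denom_real g w : -1 < w -> (forall i, (1 <= i)%nat -> 0 <= g i <= 1) ->
  forall n i, (2 <= i)%nat -> gfrac_denom g (RtoC w) n i = RtoC (rdenom g w n i).
Proof.
  intros Hw Hg. induction n as [|n IH]; intros i Hi; trivial.
  cbn [gfrac_denom rdenom]. rewrite IH by lia.
  destruct i as [|i]; [lia|].
  destruct (rdenom_tail_bounds g w Hw Hg n i) as [P _].
  rewrite <- RtoC_mult, <- RtoC_div, <- RtoC_plus by lra. reflexivity.
Qed.

Lemma is_gfrac_real g w G : -1 < w -> (forall i, (1 <= i)%nat -> 0 <= g i <= 1) ->
  is_gfrac g (RtoC w) G ->
  exists x, G = RtoC x /\ / (1 + g 1%nat * w) <= x <= (1 + (1 - g 1%nat) * w) / (1 + w).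
Proof.
  intros Hw Hg HG.
  pose proof (Hg 1%nat ltac:(lia)) as H1.
  assert (Q : 0 < 1 + (1 - g 1%nat) * w) by (destruct (Rle_dec 0 w); nra).
  assert (Q' : 0 < 1 + g 1%nat * w) by (destruct (Rle_dec 0 w); nra).
  assert (Pos : forall n, 0 < rdenom g w (S n) 1).
  { intros n. destruct (rdenom_head_bounds g w Hw Hg n) as [H _].
    apply Rlt_le_trans with (2 := H). apply Rdiv_lt_0_compat; lra. }
  assert (E : forall n, (/ gfrac_denom g (RtoC w) (S n) 1)%C = RtoC (/ rdenom g w (S n) 1)).
  { intros n. specialize (Pos n). rewrite RtoC_inv by lra. f_equal.
    cbn [gfrac_denom rdenom]. rewrite gfrac_denom_real by (trivial; lia).
    destruct (rdenom_tail_bounds g w Hw Hg n 0) as [P _].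
    rewrite <- RtoC_mult, <- RtoC_div, <- RtoC_plus by lra. reflexivity. }
  assert (Lre : is_lim_seq (fun n => / rdenom g w (S n) 1) (Re G)).
  { apply is_lim_seq_ext with (fun n => Re (/ gfrac_denom g (RtoC w) (S n) 1)%C).
    { intros n. now rewrite E. }
    apply (is_lim_seq_incr_1 (fun n => Re (/ gfrac_denom g (RtoC w) n 1)%C)).
    apply (filterlim_comp _ _ _ (fun n => (/ gfrac_denom g (RtoC w) n 1)%C) Re _ _ _ HG).
    intros P [eps H]. exists eps. intros [a b] [Ha _]. apply H. exact Ha. }
  assert (Lim : is_lim_seq (fun n => 0) (Im G)).
  { apply is_lim_seq_ext with (fun n => Im (/ gfrac_denom g (RtoC w) (S n) 1)%C).
    { intros n. now rewrite E. }
    apply (is_lim_seq_incr_1 (fun n => Im (/ gfrac_denom g (RtoC w) n 1)%C)).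
    apply (filterlim_comp _ _ _ (fun n => (/ gfrac_denom g (RtoC w) n 1)%C) Im _ _ _ HG).
    intros P [eps H]. exists eps. intros [a b] [_ Hb]. apply H. exact Hb. }
  exists (Re G). split.
  - assert (I : Im G = 0).
    { pose proof (is_lim_seq_unique _ _ Lim) as U. rewrite Lim_seq_const in U. now injection U. }
    destruct G as [a b]. simpl in *. now rewrite I.
  - split.
    + apply (is_lim_seq_le (fun _ => / (1 + g 1%nat * w)) _ (/ (1 + g 1%nat * w)) (Re G) ) with (3 := Lre).
      * intros n. apply Rinv_le_contravar; [apply Pos|apply rdenom_head_bounds; trivial].
      * apply is_lim_seq_const.
    + apply (is_lim_seq_le _ (fun _ => (1 + (1 - g 1%nat) * w) / (1 + w)) (Re G) ((1 + (1 - g 1%nat) * w) / (1 + w))) with (2 := Lre).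
      * intros n. rewrite <- (Rinv_div (1 + w)).
        apply Rinv_le_contravar; [apply Rdiv_lt_0_compat; lra|apply rdenom_head_bounds; trivial].
      * apply is_lim_seq_const.
Qed.

(** * The theorem *)

Lemma rsn_abs q u : 0 < q < 1 -> Rabs u < quarter_period q -> Rabs (rsn q u) = rsn q (Rabs u).
Proof.
  intros Hq Hu. pose proof (quarter_period_real q Hq) as EK. pose proof (quarter_period_pos q Hq).
  assert (A : forall v, 0 <= v < quarter_period q -> 0 <= rsn q v).
  { intros v [[Hv| <-] Hv']; [|rewrite rsn_0; lra].
    left. rewrite <- (rsn_0 q). apply rsn_increasing; trivial; rewrite <- EK; lra. }
  destruct (Rle_dec 0 u) as [Hs|Hs].
  - rewrite (Rabs_pos_eq u) in * by trivial. apply Rabs_pos_eq, A. lra.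
  - rewrite (Rabs_left u) in * by lra. rewrite rsn_odd by trivial.
    apply Rabs_left1. rewrite <- (Ropp_involutive u), rsn_odd by trivial.
    pose proof (A (- u) ltac:(lra)). lra.
Qed.

(** Each hypothesis has the factor W - 1.  For W > 1 they become a (W + 1) >= 1 and
    (1 - a) (W + 1) >= 1, that is, a W >= 1 - a and (1 - a) W >= a; for W < 1 the inequalities
    are reversed.  Clearing denominators in the conclusion leaves exactly the squares of
    these, one for each sign of 1 - 2a. *)
Lemma gfrac_gap a W : 0 < a < 1 -> 0 < W -> W <> 1 ->
  W <= 1 + a * (W ^ 2 - 1) -> W <= 1 + (1 - a) * (W ^ 2 - 1) ->
  Rabs ((1 - 2 * a) / (a ^ 2 + (1 - a) ^ 2)) <= Rabs ((W ^ 2 - 1) / (W ^ 2 + 1)).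
Proof.
  intros Ha HW HW1 H1 H2.
  assert (D : 0 < a ^ 2 + (1 - a) ^ 2) by nra.
  assert (D' : 0 < W ^ 2 + 1) by nra.
  unfold Rdiv. rewrite !Rabs_mult, !Rabs_inv.
  rewrite (Rabs_pos_eq (a ^ 2 + _)), (Rabs_pos_eq (W ^ 2 + 1)) by lra.
  apply Rmult_le_reg_r with ((a ^ 2 + (1 - a) ^ 2) * (W ^ 2 + 1)); [now apply Rmult_lt_0_compat|].
  replace (Rabs (1 - 2 * a) * / (a ^ 2 + (1 - a) ^ 2) * ((a ^ 2 + (1 - a) ^ 2) * (W ^ 2 + 1)))
    with (Rabs (1 - 2 * a) * (W ^ 2 + 1)) by (field; lra).
  replace (Rabs (W ^ 2 - 1) * / (W ^ 2 + 1) * ((a ^ 2 + (1 - a) ^ 2) * (W ^ 2 + 1)))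
    with (Rabs (W ^ 2 - 1) * (a ^ 2 + (1 - a) ^ 2)) by (field; lra).
  destruct (Rtotal_order W 1) as [L|[L|L]]; [|lra|].
  - assert (A1 : a * (W + 1) <= 1).
    { apply Rmult_le_reg_l with (1 - W); [lra|]. nra. }
    assert (A2 : (1 - a) * (W + 1) <= 1).
    { apply Rmult_le_reg_l with (1 - W); [lra|]. nra. }
    rewrite (Rabs_left (W ^ 2 - 1)) by nra.
    assert (B1 : (a * W) ^ 2 <= (1 - a) ^ 2) by (apply pow_incr; nra).
    assert (B2 : ((1 - a) * W) ^ 2 <= a ^ 2) by (apply pow_incr; nra).
    destruct (Rle_dec 0 (1 - 2 * a)); [rewrite Rabs_pos_eq by trivial|rewrite Rabs_left by lra]; nra.
  - assert (A1 : 1 <= a * (W + 1)).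
    { apply Rmult_le_reg_l with (W - 1); [lra|]. nra. }
    assert (A2 : 1 <= (1 - a) * (W + 1)).
    { apply Rmult_le_reg_l with (W - 1); [lra|]. nra. }
    rewrite (Rabs_pos_eq (W ^ 2 - 1)) by nra.
    assert (B1 : (1 - a) ^ 2 <= (a * W) ^ 2) by (apply pow_incr; nra).
    assert (B2 : a ^ 2 <= ((1 - a) * W) ^ 2) by (apply pow_incr; nra).
    destruct (Rle_dec 0 (1 - 2 * a)); [rewrite Rabs_pos_eq by trivial|rewrite Rabs_left by lra]; nra.
Qed.

(** The value of sqrt(1 + Phi) at a point where sn takes the value [s]. *)
Definition sqrt_cayley (s : R) : R := sqrt ((1 + s) / (1 - s)).

Lemma sqrt_cayley_spec s : -1 < s < 1 ->
  0 < sqrt_cayley s /\ sqrt_cayley s ^ 2 = (1 + s) / (1 - s).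
Proof.
  intros Hs. assert (P : 0 < (1 + s) / (1 - s)) by (apply Rdiv_lt_0_compat; lra).
  split; [now apply sqrt_lt_R0|apply pow2_sqrt; lra].
Qed.

(** The two extreme values of the g-fraction of given first coefficient enclose [V], the product
    of the square root and the g-fraction. *)
Lemma gfrac_representation_real M T B f mu0 g x : 0 < T -> 0 < B ->
  gfrac_representation M T B f mu0 g -> - T < x < T ->
  let W := sqrt_cayley (rsn (nome T B) (quarter_period (nome T B) / T * x)) in
  exists V, W / (1 + g 1%nat * (W ^ 2 - 1)) <= V <= (1 + (1 - g 1%nat) * (W ^ 2 - 1)) / W
    /\ 0 < 1 + g 1%nat * (W ^ 2 - 1)
    /\ f (RtoC x) = RtoC (M * (1 - 2 / (mu0 * V + 1))).
Proof.
  intros HT HB (Hmu & Hg & Hf) Hx.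
  destruct (Phi_real T B x HT HB Hx) as [Hs HPhi].
  set (s := rsn (nome T B) (quarter_period (nome T B) / T * x)) in *.
  intros W. destruct (sqrt_cayley_spec s Hs) as [HW HW2]. fold W in HW, HW2.
  destruct (Hf (RtoC x)) as [G [HG Efx]].
  { split; simpl; [now apply Rabs_def1|rewrite Rabs_R0; lra]. }
  rewrite HPhi in HG, Efx.
  assert (HW3 : 0 < W ^ 2) by now apply pow_lt.
  assert (Ew : 2 * s / (1 - s) = W ^ 2 - 1) by (rewrite HW2; field; lra).
  rewrite Ew in HG, Efx.
  destruct (is_gfrac_real g (W ^ 2 - 1) G ltac:(lra) Hg HG) as [y [-> Hy]].
  pose proof (Hg 1%nat ltac:(lia)) as H1.
  assert (Q : 0 < 1 + g 1%nat * (W ^ 2 - 1)).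
  { replace (1 + g 1%nat * (W ^ 2 - 1)) with ((1 - g 1%nat) + g 1%nat * W ^ 2) by ring.
    destruct (Req_dec (g 1%nat) 0) as [->|]; [lra|]. assert (0 < g 1%nat * W ^ 2) by (apply Rmult_lt_0_compat; lra). lra. }
  assert (Hy0 : 0 < y) by (apply Rlt_le_trans with (2 := proj1 Hy); now apply Rinv_0_lt_compat).
  exists (W * y). split; [|split; trivial].
  - split.
    + unfold Rdiv. apply Rmult_le_compat_l; lra.
    + apply Rle_trans with (W * ((1 + (1 - g 1%nat) * (W ^ 2 - 1)) / (1 + (W ^ 2 - 1)))).
      * apply Rmult_le_compat_l; lra.
      * right. field. split; lra.
  - rewrite Efx. rewrite <- RtoC_plus, Csqrt_pos by lra.
    replace (sqrt (1 + (W ^ 2 - 1))) with W.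
    2:{ replace (1 + (W ^ 2 - 1)) with (W ^ 2) by ring. symmetry. apply sqrt_pow2. lra. }
    assert (0 < mu0 * W * y) by (repeat apply Rmult_lt_0_compat; trivial).
    rewrite <- !RtoC_mult, <- RtoC_plus, <- RtoC_div by lra.
    rewrite <- RtoC_minus, <- RtoC_mult. do 5 f_equal. ring.
Qed.

Lemma is_derive_at_min (D : R -> R) l d : 0 < d ->
  (forall x, - d < x < d -> D 0 <= D x) -> is_derive D 0 l -> l = 0.
Proof.
  intros Hd Hmin HD. apply is_derive_Reals in HD.
  rewrite <- (derive_pt_eq_0 D 0 l (exist _ l HD) HD).
  apply (deriv_minimum D (- d) d 0); try lra. intros x H1 H2. apply Hmin. lra.
Qed.

Lemma is_derive_sqrt_cayley_0 : is_derive sqrt_cayley 0 1.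
Proof.
  replace 1 with (2 * / (2 * sqrt ((1 + 0) / (1 - 0)))).
  2:{ replace ((1 + 0) / (1 - 0)) with 1 by field. rewrite sqrt_1. field. }
  apply (is_derive_sqrt (fun s => (1 + s) / (1 - s)) 0 2).
  - auto_derive; [lra|field].
  - lra.
Qed.

(** The function of s that f becomes when V is replaced by its lower bound. *)
Lemma is_derive_lower_envelope M mu0 a : 0 < mu0 ->
  is_derive (fun s => M * (1 - 2 / (mu0 *
    (sqrt_cayley s / (1 + a * (sqrt_cayley s ^ 2 - 1))) + 1))) 0
    (2 * M * mu0 * (1 - 2 * a) / (mu0 + 1) ^ 2).
Proof.
  intros Hmu.
  replace (2 * M * mu0 * (1 - 2 * a) / (mu0 + 1) ^ 2)
    with (scal 1 (2 * M * mu0 * (1 - 2 * a) / (mu0 + 1) ^ 2)) by apply Rmult_1_l.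
  apply (is_derive_comp (fun W => M * (1 - 2 / (mu0 * (W / (1 + a * (W ^ 2 - 1))) + 1))) sqrt_cayley);
    [|apply is_derive_sqrt_cayley_0].
  replace (sqrt_cayley 0) with 1.
  2:{ unfold sqrt_cayley. replace ((1 + 0) / (1 - 0)) with 1 by field. now rewrite sqrt_1. }
  assert (E : 1 + a * (1 * (1 * 1) + - (1)) = 1) by ring.
  auto_derive.
  - rewrite E. repeat split; lra.
  - rewrite E. field. lra.
Qed.

Lemma rsn_slope_0 (q c : R) : 0 < q < 1 -> is_derive (fun x : R => rsn q (c * x)) 0 c.
Proof.
  intros Hq. pose proof (th2_0_pos q Hq). pose proof (th3_pos q Hq 0). pose proof (th4_pos q 0 Hq).
  assert (D : is_derive (fun x : R => rsn q (c * x)) 0 (scal c 1)); [|now rewrite (Rmult_1_r c : scal c 1 = c) in D].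
  apply (is_derive_comp (rsn q) (fun x => c * x)).
  - replace (c * 0) with 0 by ring.
    replace 1 with (rcn q 0 * rdn q 0); [now apply is_derive_rsn|].
    unfold rcn, rdn. replace (0 / th3 q 0 ^ 2) with 0 by (unfold Rdiv; ring). field. lra.
  - auto_derive; trivial. ring.
Qed.

(** The real part of f lies above the function built from the lower bound for V and agrees with
    it at 0; being differentiable there, it has the same derivative.  The imaginary part vanishes
    on the real axis. *)
Lemma gfrac_representation_derive M T B f mu0 g l : 0 < M -> 0 < T -> 0 < B ->
  gfrac_representation M T B f mu0 g ->
  is_derive (K := C_AbsRing) (V := C_NormedModule) f (RtoC 0) l ->
  l = RtoC (2 * M * mu0 * (1 - 2 * g 1%nat) / (mu0 + 1) ^ 2 * (quarter_period (nome T B) / T)).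
Proof.
  intros HM HT HB Hrep Hl. pose proof Hrep as (Hmu & _ & _).
  set (q := nome T B). assert (Hq : 0 < q < 1) by now apply nome_in_01.
  set (c := quarter_period q / T).
  set (a := g 1%nat).
  assert (Val : forall x, - T < x < T -> _)
    by exact (fun x => gfrac_representation_real M T B f mu0 g x HT HB Hrep).
  cbv zeta in Val. fold q in Val. fold c in Val. fold a in Val.
  destruct (is_derive_Re_Im_real f l Hl) as [DRe DIm].
  set (H := fun s => M * (1 - 2 / (mu0 * (sqrt_cayley s / (1 + a * (sqrt_cayley s ^ 2 - 1))) + 1))).
  assert (W0 : sqrt_cayley 0 = 1).
  { unfold sqrt_cayley. replace ((1 + 0) / (1 - 0)) with 1 by field. apply sqrt_1. }
  assert (H0 : H 0 = M * (1 - 2 / (mu0 * 1 + 1))).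
  { unfold H. rewrite W0. do 6 f_equal. field. }
  assert (S0 : rsn q (c * 0) = 0) by (rewrite Rmult_0_r; apply rsn_0).
  assert (ImZ : Im l = 0).
  { apply (is_derive_at_min (fun x => Im (f (RtoC x))) (Im l) T HT); trivial.
    intros x Hx. destruct (Val x Hx) as (V & _ & _ & ->).
    destruct (Val 0 ltac:(lra)) as (V' & _ & _ & ->). simpl. lra. }
  assert (ReZ : Re l - c * (2 * M * mu0 * (1 - 2 * a) / (mu0 + 1) ^ 2) = 0).
  { apply (is_derive_at_min (fun x => Re (f (RtoC x)) - H (rsn q (c * x))) _ T HT).
    - intros x Hx. destruct (Val x Hx) as (V & HV & Q & ->).
      destruct (Val 0 ltac:(lra)) as (V' & HV' & _ & ->).
      rewrite S0 in HV' |- *. rewrite H0. rewrite W0 in HV'.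
      replace (1 ^ 2 - 1) with 0 in HV' by ring. rewrite !Rmult_0_r, !Rplus_0_r in HV'.
      unfold Rdiv in HV'. rewrite Rinv_1, Rmult_1_l in HV'.
      replace V' with 1 by lra. simpl Re. unfold H.
      set (W := sqrt_cayley (rsn q (c * x))) in *.
      destruct (Phi_real T B x HT HB Hx) as [Hs _]. fold q in Hs. fold c in Hs.
      destruct (sqrt_cayley_spec _ Hs) as [HW _]. fold W in HW.
      assert (P1 : 0 < W / (1 + a * (W ^ 2 - 1))) by now apply Rdiv_lt_0_compat.
      set (V1 := W / (1 + a * (W ^ 2 - 1))) in *.
      assert (0 < mu0 * V1) by now apply Rmult_lt_0_compat.
      assert (mu0 * V1 <= mu0 * V) by (apply Rmult_le_compat_l; lra).
      assert (2 / (mu0 * V + 1) <= 2 / (mu0 * V1 + 1)).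
      { apply Rmult_le_compat_l; [lra|]. apply Rinv_le_contravar; lra. }
      assert (M * (2 / (mu0 * V + 1)) <= M * (2 / (mu0 * V1 + 1))) by (apply Rmult_le_compat_l; lra).
      lra.
    - apply (is_derive_minus (fun x => Re (f (RtoC x))) (fun x => H (rsn q (c * x)))); trivial.
      apply (is_derive_comp H (fun x => rsn q (c * x))); [|now apply rsn_slope_0].
      rewrite S0. now apply is_derive_lower_envelope. }
  destruct l as [l1 l2]. simpl in *. rewrite ImZ. unfold RtoC. f_equal. lra.
Qed.

Theorem theorem2p1 (M T B : R) (hM : 0 < M) (hT : 0 < T) (hB : 0 < B)
  (f : C -> C) (hf : class_A_k 1 M T B f)
  (hf' : C_derive f (RtoC 0) <> RtoC 0)
  (tau : R) (htau : - T < tau < T) (htau0 : tau <> 0)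
  (hftau : f (RtoC tau) = f (RtoC 0)) :
  let q := nome T B in
  let K := quarter_period q in
  let k := modulus q in
  let phi0 := Re (f (RtoC 0)) / M in
  let phi1 := T / K * (Re (C_derive f (RtoC 0)) / M) in
  let g1 := / 2 * ((1 - phi0 ^ 2 - 2 * phi1) / (1 - phi0 ^ 2)) in
  let g := (1 - 2 * g1) / (g1 ^ 2 + (1 - g1) ^ 2) in
  let tautilde := T / K * Rabs (arcsn q g) in
  -1 < g < 1
  /\ tautilde =
       T / K * Rabs (RInt (fun t => / (sqrt (1 - t ^ 2) * sqrt (1 - k ^ 2 * t ^ 2))) 0 g)
  /\ 0 < tautilde < T
  /\ Rabs tau >= tautilde.
Proof.
  intros q K k phi0 phi1 g1 g tautilde.
  destruct hf as [[hana _] [mu0 [gs [Hrep Hne]]]].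
  pose proof Hrep as (Hmu & Hg & _).
  destruct (Hne 1%nat ltac:(lia)) as [Ha0 Ha1]. pose proof (Hg 1%nat ltac:(lia)) as Ha.
  set (a := gs 1%nat) in *.
  assert (Hq : 0 < q < 1) by now apply nome_in_01.
  assert (HK : 0 < K) by now apply quarter_period_pos.
  assert (Hd : C_derive f (RtoC 0) = RtoC (2 * M * mu0 * (1 - 2 * a) / (mu0 + 1) ^ 2 * (K / T))).
  { apply (gfrac_representation_derive M T B f mu0 gs); trivial.
    apply C_derive_correct; [exact (RtoC 0)|]. apply hana.
    split; simpl; rewrite Rabs_R0; trivial. }
  assert (Hc : 1 - 2 * a <> 0).
  { intros Z. apply hf'. rewrite Hd, Z. f_equal. unfold Rdiv. ring. }
  destruct (gfrac_representation_real M T B f mu0 gs 0 hT hB Hrep ltac:(lra)) as (V0 & HV0 & _ & E0).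
  destruct (gfrac_representation_real M T B f mu0 gs tau hT hB Hrep htau) as (V & HV & Q & Et).
  fold q K a in HV0, HV, Q.
  rewrite Rmult_0_r, rsn_0 in HV0.
  replace (sqrt_cayley 0) with 1 in HV0.
  2:{ unfold sqrt_cayley. replace ((1 + 0) / (1 - 0)) with 1 by field. now rewrite sqrt_1. }
  assert (EV0 : V0 = 1).
  { replace (1 ^ 2 - 1) with 0 in HV0 by ring. rewrite !Rmult_0_r, !Rplus_0_r in HV0.
    unfold Rdiv in HV0. rewrite Rinv_1, Rmult_1_l in HV0. lra. }
  subst V0.
  destruct (Phi_real T B tau hT hB htau) as [Hs _]. fold q K in Hs.
  set (s := rsn q (K / T * tau)) in *.
  destruct (sqrt_cayley_spec s Hs) as [HW HW2].
  set (W := sqrt_cayley s) in *.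
  assert (HVpos : 0 < V).
  { apply Rlt_le_trans with (2 := proj1 HV). now apply Rdiv_lt_0_compat. }
  assert (EV : V = 1).
  { rewrite Et, E0 in hftau. apply RtoC_inj in hftau.
    assert (0 < mu0 * V) by now apply Rmult_lt_0_compat.
    apply Rmult_eq_reg_l in hftau; [|lra].
    assert (I : / (mu0 * V + 1) = / (mu0 * 1 + 1)) by (unfold Rdiv in hftau; lra).
    apply Rinv_eq_reg in I. nra. }
  subst V. destruct HV as [HV HV'].
  assert (Eg1 : g1 = a).
  { unfold g1, phi1, phi0. rewrite Hd, E0. simpl Re. field. repeat split; lra. }
  assert (Eg : g = (1 - 2 * a) / (a ^ 2 + (1 - a) ^ 2)) by (unfold g; now rewrite Eg1).
  assert (Dg : 0 < a ^ 2 + (1 - a) ^ 2) by nra.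
  assert (Hg1 : -1 < g < 1).
  { assert (0 < a) by lra. assert (0 < 1 - a) by lra.
    rewrite Eg. split; apply Rmult_lt_reg_r with (a ^ 2 + (1 - a) ^ 2); trivial;
    (replace ((1 - 2 * a) / (a ^ 2 + (1 - a) ^ 2) * (a ^ 2 + (1 - a) ^ 2)) with (1 - 2 * a)
      by (field; lra)); nra. }
  assert (Hg0 : g <> 0).
  { rewrite Eg. apply Rmult_integral_contrapositive_currified; [trivial|].
    apply Rinv_neq_0_compat. lra. }
  destruct (arcsn_spec q g Hq Hg1) as [Hy Ey]. fold K in Hy.
  set (y := arcsn q g) in *.
  assert (Hu : Rabs (K / T * tau) < K).
  { unfold Rdiv. rewrite Rmult_assoc, Rabs_mult, Rabs_pos_eq by lra.
    rewrite <- (Rmult_1_r K) at 2. apply Rmult_lt_compat_l; trivial.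
    apply Rabs_def1; apply Rmult_lt_reg_l with T; trivial; field_simplify; lra. }
  assert (HTK : 0 < T / K) by now apply Rdiv_lt_0_compat.
  split; [trivial|]. split; [|split].
  - unfold tautilde. do 2 f_equal. symmetry. rewrite <- Ey at 1.
    unfold k, modulus. rewrite theta2_0_eq, theta3_0_eq by trivial.
    apply rsn_integral; trivial. now rewrite <- quarter_period_real.
  - unfold tautilde. split.
    + apply Rmult_lt_0_compat; trivial. apply Rabs_pos_lt.
      intros Z. apply Hg0. fold y in Z. rewrite <- Ey, Z. apply rsn_0.
    + fold y. replace T with (T / K * K) at 2 by (field; lra). now apply Rmult_lt_compat_l.
  - assert (Hgs : Rabs g <= Rabs s).
    { replace s with ((W ^ 2 - 1) / (W ^ 2 + 1)) by (rewrite HW2; field; lra).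
      rewrite Eg. apply gfrac_gap; trivial; try lra.
      (* W = 1 would mean that sn vanishes at a nonzero point of (-K,K). *)
      - intros W1. rewrite W1, pow1 in HW2.
        assert (Z : s = 0).
        { apply (f_equal (fun x => x * (1 - s))) in HW2.
          replace ((1 + s) / (1 - s) * (1 - s)) with (1 + s) in HW2 by (field; lra). lra. }
        assert (Hpos : 0 < Rabs (K / T * tau)).
        { apply Rabs_pos_lt. apply Rmult_integral_contrapositive_currified; trivial.
          apply Rgt_not_eq. now apply Rdiv_lt_0_compat. }
        assert (Hinc : rsn q 0 < rsn q (Rabs (K / T * tau)))
          by (apply rsn_increasing; trivial; rewrite <- quarter_period_real by trivial; fold K; lra).
        rewrite <- rsn_abs, rsn_0 in Hinc by trivial. fold s in Hinc.
        rewrite Z, Rabs_R0 in Hinc. lra.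
      - apply (Rmult_le_compat_r (1 + a * (W ^ 2 - 1))) in HV; [|lra].
        rewrite Rmult_1_l in HV. unfold Rdiv in HV. rewrite Rmult_assoc, Rinv_l in HV; lra.
      - apply (Rmult_le_compat_r W) in HV'; [|lra].
        rewrite Rmult_1_l in HV'. unfold Rdiv in HV'. rewrite Rmult_assoc, Rinv_l in HV'; lra. }
    unfold tautilde. fold y. apply Rle_ge, Rnot_lt_le. intros L.
    assert (Lu : Rabs (K / T * tau) < Rabs y).
    { rewrite Rabs_mult, Rabs_pos_eq by (left; now apply Rdiv_lt_0_compat).
      apply Rmult_lt_reg_l with (T / K); trivial.
      replace (T / K * (K / T * Rabs tau)) with (Rabs tau) by (field; lra). trivial. }
    assert (rsn q (Rabs (K / T * tau)) < rsn q (Rabs y)).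
    { pose proof (Rabs_pos (K / T * tau)).
      apply rsn_increasing; trivial; rewrite <- quarter_period_real by trivial; fold K; lra. }
    rewrite <- !rsn_abs in H by trivial. fold s in H. rewrite Ey in H. lra.
Qed.
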